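(* Let $K$ be a virtual knot diagram formed by a single virtual crossing and a classical tangle $T$, and let $\alpha,\beta\in\mathbb{Z}[A,A^{-1}]$ be the coefficients of the bracket expansion of $T$ in the two crossingless tangles. If $\alpha\neq 0$ and $\beta\neq 0$, then $K$ is non-classical and non-trivial.
   Context: A virtual knot or link is an equivalence class of planar diagrams with classical and virtual crossings, under the classical Reidemeister moves together with the move replacing an arc containing only virtual crossings by any other arc with the same endpoints (all of whose new crossings are virtual). It is non-classical if it is not equivalent to any diagram without virtual crossings, and non-trivial if it is not equivalent to a crossingless diagram. The virtual crossing lies in a disk meeting $K$ only in that crossing and four ends; the complementary part of the diagram is a tangle $T$ with four ends having only classical crossings. The Kauffman bracket is given by $\langle \text{crossing}\rangle = A\langle A\text{-smoothing}\rangle + A^{-1}\langle B\text{-smoothing}\rangle$, with a disjoint trivial loop contributing the factor $d=-A^2-A^{-2}$. Expanding $T$ with these relations gives $\langle T\rangle = \alpha\langle E_\alpha\rangle+\beta\langle E_\beta\rangle$, where $E_\alpha,E_\beta$ are the two crossingless tangles with the same four ends. *)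

(* Defs.v *)
(* Virtual knot and link diagrams are represented by 4-regular planar maps:
   diagrams are considered up to orientation-preserving homeomorphism of the
   sphere, and the relative position of the connected components of a split
   diagram is not recorded, which does not affect equivalence. *)
From mathcomp Require Import all_boot all_order all_algebra.
From Stdlib Require Import Relation_Operators.

Set Implicit Arguments.
Unset Strict Implicit.
Unset Printing Implicit Defensive.

Import GRing.Theory.

(* Around a crossing x, the half-edges (darts) (x, 0), ..., (x, 3) are listed
   counterclockwise; if x is classical, (x, 0) and (x, 2) belong to the
   underpassing strand and (x, 1) and (x, 3) to the overpassing one.  [mate]
   exchanges the two ends of an edge.  Components without any crossing are not
   seen by darts: they are counted by [circles].
   A pre-diagram is not required to be drawn in the plane. *)
Record prediagram := Prediagram {
  crossing : finType;
  virtual : pred crossing;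
  mate : crossing * 'I_4 -> crossing * 'I_4;
  circles : nat;
  mateK : involutive mate;
  mate_neq : forall d, mate d != d
}.

Notation dart D := (crossing D * 'I_4)%type.

Section Prediagram.

Variable D : prediagram.
Implicit Types (d e : dart D) (S : {set crossing D}).

Definition rot4 d : dart D := (d.1, ordS d.2).

Definition straight d : dart D := rot4 (rot4 d).

Definition over d : bool := odd d.2.

(* The orbits of [face] are the boundary walks of the faces. *)
Definition face d : dart D := rot4 (mate d).

Definition graph_rel : rel (dart D) :=
  [rel d e | (e == mate d) || (e == rot4 d)].

(* Euler's formula V - E + F = 2 C with E = 2 V: every connected component of
   the underlying 4-regular map has genus 0. *)
Definition planar : bool :=
  fcard face {: dart D} == #|crossing D| + 2 * n_comp graph_rel {: dart D}.

Definition strand_rel : rel (dart D) :=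
  [rel d e | (e == mate d) || (e == straight d)].

(* The number of components of the link. *)
Definition components : nat := circles D + n_comp strand_rel {: dart D}.

Definition no_virtual : Prop := forall x : crossing D, ~~ virtual x.

Definition crossingless : Prop := #|crossing D| = 0.

(* One step along a strand, which stops on leaving the crossings of S. *)
Definition pass S d : dart D :=
  if d.1 \in S then mate (straight d) else d.

Definition closed_in S : pred (dart D) :=
  [pred d | [forall e, connect strand_rel d e ==> (e.1 \in S)]].

End Prediagram.

Definition compatible (D D' : prediagram) (f : dart D -> dart D') : Prop :=
  [/\ forall d, f (rot4 d) = rot4 (f d),
      forall d, virtual (f d).1 = virtual d.1
    & forall d, ~~ virtual d.1 -> over (f d) = over d].

(* [erased S f]: up to the relabelling f, D0 is what remains of D when the
   crossings of S are forgotten, the strands going straight through them.  In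
   general D0 is only a pre-diagram, even if D is planar. *)
Definition erased (D D0 : prediagram) (S : {set crossing D})
    (f : dart D0 -> dart D) : Prop :=
  [/\ injective f,
      compatible f,
      forall e : dart D, (e \in codom f) = (e.1 \notin S),
      forall d : dart D0, exists n, f (mate d) = iter n (pass S) (mate (f d))
    & circles D0 = circles D + n_comp (@strand_rel D) (closed_in S)].

Record diagram := Diagram {
  diagram_pre :> prediagram;
  diagram_planar : planar diagram_pre
}.

Section Moves.

Variables D D' : diagram.

Definition isomorphic : Prop :=
  exists f : dart D' -> dart D, erased set0 f.

Definition Reidemeister1 : Prop :=
  exists (d : dart D) (f : dart D' -> dart D),
    [/\ ~~ virtual d.1, face d = d & erased [set d.1] f].

(* d runs along the side of the bigon which passes over at both corners. *)
Definition Reidemeister2 : Prop :=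
  exists (d : dart D) (f : dart D' -> dart D),
    [/\ face (face d) = d /\ (face d).1 != d.1,
        ~~ virtual d.1 /\ ~~ virtual (face d).1,
        over d && over (mate d)
      & erased [set d.1; (face d).1] f].

Definition triangle (d : dart D) : seq (dart D) :=
  [:: d; face d; face (face d)].

(* The third move exchanges the two crossings met by each strand of the
   triangle.  If p - (x,a) (x,a+2) - (y,b) (y,b+2) - q are the successive darts
   of such a strand, it becomes p - (y,b) (y,b+2) - (x,a) (x,a+2) - q, that is,
   (x,a) and (y,b) are exchanged, as well as (x,a+2) and (y,b+2). *)
Definition swap3 (d e : dart D) : dart D :=
  if e.1 \notin [seq c.1 | c <- triangle d] then e
  else if (e \in triangle d) || (mate e \in triangle d) then straight (mate e)
  else mate (straight e).

(* d runs along the side of the triangle which passes over at both corners. *)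
Definition Reidemeister3 : Prop :=
  exists (d : dart D) (f : dart D -> dart D'),
    [/\ face (face (face d)) = d /\ uniq [seq c.1 | c <- triangle d],
        {in triangle d, forall c, ~~ virtual c.1},
        over d && over (mate d),
        bijective f /\ compatible f
      & (forall e, mate (f e) = f (swap3 d (mate (swap3 d e))))
        /\ circles D' = circles D].

(* D and D' only differ by the course of an arc joining the same darts of a
   common pre-diagram D0; the arc is the edge at d0 in D0, and all the
   crossings met by it in D (those of S) and in D' (those of S') are virtual. *)
Definition detour : Prop :=
  exists (D0 : prediagram) (d0 : dart D0)
         (S : {set crossing D}) (f : dart D0 -> dart D)
         (S' : {set crossing D'}) (f' : dart D0 -> dart D'),
    [/\ {in S, forall x, virtual x /\
           exists n, (iter n (pass S) (mate (f d0))).1 = x},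
        {in S', forall x, virtual x /\
           exists n, (iter n (pass S') (mate (f' d0))).1 = x},
        erased S f
      & erased S' f'].

(* The case of an arc which, once all its crossings (those of S) are removed,
   closes up to a component without crossings. *)
Definition detour_circle : Prop :=
  exists (c : dart D) (S : {set crossing D}) (f : dart D' -> dart D),
    [/\ closed_in S c,
        {in S, forall x, virtual x /\
           exists i, connect (@strand_rel D) c (x, i)}
      & erased S f].

Definition move : Prop :=
  isomorphic \/ Reidemeister1 \/ Reidemeister2 \/ Reidemeister3 \/
  detour \/ detour_circle.

End Moves.

Definition equivalent : diagram -> diagram -> Prop :=
  clos_refl_sym_trans diagram move.

Definition non_classical (K : diagram) : Prop :=
  ~ exists D : diagram, equivalent K D /\ no_virtual D.

Definition non_trivial (K : diagram) : Prop :=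
  ~ exists D : diagram, equivalent K D /\ crossingless D.

Definition is_knot (K : diagram) : Prop := components K = 1.

(* The two ways of joining four cyclically ordered ends without crossings:
   0-1, 2-3 and 1-2, 3-0.  With the conventions above, they are also the A- and
   the B-smoothing of a classical crossing: turning the overpassing strand
   counterclockwise sweeps the corners (1, 2) and (3, 0), which are merged by
   the A-smoothing. *)
Definition join01 (i : 'I_4) : 'I_4 := if odd i then ord_pred i else ordS i.
Definition join12 (i : 'I_4) : 'I_4 := if odd i then ordS i else ord_pred i.

Local Open Scope ring_scope.

(* Z[A, A^-1] is viewed inside the field of fractions of Z[A]. *)
Notation ratfun := {fraction {poly int}}.

Definition varA : ratfun := tofrac ('X : {poly int}).

Definition loop_value : ratfun := - varA ^+ 2 - varA ^- 2.

Section Bracket.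

Variable K : prediagram.
Implicit Types (s : {set crossing K}) (v : crossing K).

Definition classical_crossings : {set crossing K} :=
  [set x | ~~ virtual x].

(* A state of the classical crossings is given by the set s of those which
   receive the A-smoothing. *)
Definition smooth s (d : dart K) : dart K :=
  (d.1, if d.1 \in s then join01 d.2 else join12 d.2).

(* The curves of a state stop at the darts of the virtual crossings, which are
   the ends of the tangle formed by the classical crossings. *)
Definition state_rel s : rel (dart K) :=
  [rel d e | (e == mate d) || (~~ virtual d.1 && (e == smooth s d))].

Definition state_loops s : nat :=
  (circles K
  + n_comp (state_rel s)
      [pred d | [forall e, connect (state_rel s) d e ==> ~~ virtual e.1]])%N.

Definition state_joins s v (E : 'I_4 -> 'I_4) : bool :=
  [forall i, connect (state_rel s) (v, i) (v, E i)].

(* If v is the only virtual crossing of K, this is the coefficient of the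
   crossingless tangle E in the bracket expansion of the tangle T complementary
   to v, the ends of T being the four darts of v. *)
Definition tangle_coef v (E : 'I_4 -> 'I_4) : ratfun :=
  \sum_(s : {set crossing K} |
          (s \subset classical_crossings) && state_joins s v E)
     varA ^+ #|s| * varA ^- #|classical_crossings :\: s|
       * loop_value ^+ state_loops s.

End Bracket.

(* Main.v *)
(* The bracket <D> of a virtual diagram D, whose states smooth the classical
   crossings and go straight through the virtual ones, is invariant under all
   the moves up to a factor (- A ^ 3) ^ n.  Say that it is graded if its
   exponents are congruent to each other modulo 4; this is preserved too.

   Planarity and Euler's formula yield a two-colouring of the darts exchanged
   by [mate] and [rot4] (the checkerboard colouring).  It orients the curves of
   a state in which every crossing is smoothed, as the orbits of a permutation,
   and changing one smoothing composes this permutation with a transposition: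
   the number of curves changes its parity.  Hence the bracket of a classical
   diagram is graded.  If v is the only virtual crossing of K, smoothing v so
   as to close the curves of a state shows that the coefficients alpha and
   beta are graded, with exponents which differ by 2 modulo 4, while
   <K> = d (alpha + beta).  So if neither vanishes, <K> is not graded. *)
Require Import Defs.
From mathcomp Require Import all_boot all_order all_algebra all_fingroup.
From mathcomp Require Import zify ring.

Set Implicit Arguments.
Unset Strict Implicit.
Unset Printing Implicit Defensive.

(* [Defs] comes last because its [over] is hidden by a later import. *)
Import GRing.Theory Defs.
Local Open Scope ring_scope.

(** * Exponents modulo 4 *)

(** Changing a smoothing from B to A raises the exponent of the weight by 2, and an odd change in
    the number of curves shifts exponents by 2 more, those of d being 2 and -2: modulo 4 the shifts
    cancel. So 4 is the right modulus, and only parities of numbers of curves matter. The obstacle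
    is that planarity is just a numerical identity, without a Jordan curve theorem. That a state of
    T joins its ends as one of the two crossingless tangles has to be derived from the colouring and
    from parity. The shift by 2 between alpha and beta comes from the closing at v: a state joining
    0-1 and 2-3 becomes a single curve through v by the B-smoothing of v, a state joining 1-2 and
    3-0 by its A-smoothing, and this adds one to the number of A-smoothings. Invariance under the
    moves meets another difficulty: they are given by gluings of darts, not by pictures. Curves are
    therefore counted through the Boolean functions constant along them, 2 to the number of curves,
    which turns a local change into a finite check of equations. *)

Definition graded (k : nat) (x : ratfun) : Prop :=
  exists n (p : {poly int}),
    x * varA ^+ (4 * n) = tofrac p /\
    forall i, p`_i != 0 -> i = k %[mod 4].

Lemma varA_neq0 : varA != 0.
Proof. by rewrite tofrac_eq0 polyX_eq0. Qed.

(** Denominators are powers of [A ^ 4] only, so enlarging them preserves the residues of exponents;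
    two elements can thus be put over the same denominator. *)
Lemma gradedP (k n m : nat) x (p : {poly int}) :
    x * varA ^+ (4 * n) = tofrac p -> (forall i, p`_i != 0 -> i = k %[mod 4]) ->
  (n <= m)%N ->
  exists q : {poly int}, x * varA ^+ (4 * m) = tofrac q /\
    forall i, q`_i != 0 -> i = k %[mod 4].
Proof.
move=> xp pk le_nm; exists (p * 'X^(4 * (m - n))); split.
  by rewrite tofracM -xp tofracXn -mulrA -exprD -mulnDr subnKC.
move=> i; rewrite coefMXn; case: ltnP => [|le_i]; first by rewrite eqxx.
by move/pk; lia.
Qed.

Lemma graded_mod k l x : k = l %[mod 4] -> graded k x -> graded l x.
Proof. by move=> kl [n [p [xp pk]]]; exists n, p; split=> // i /pk->. Qed.

Lemma graded0 k : graded k 0.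
Proof.
by exists 0, 0; rewrite mul0r tofrac0; split=> // i; rewrite coef0 eqxx.
Qed.

Lemma gradedD k x y : graded k x -> graded k y -> graded k (x + y).
Proof.
case=> n [p [xp pk]] [m [q [yq qk]]].
have [p' [{}xp {}pk]] := gradedP xp pk (leq_addr m n).
have [q' [{}yq {}qk]] := gradedP yq qk (leq_addl n m).
exists (n + m)%N, (p' + q'); rewrite mulrDl tofracD xp yq; split=> // i.
rewrite coefD; have [-> |/pk //] := eqVneq p'`_i 0.
by rewrite add0r => /qk.
Qed.

Lemma gradedN k x : graded k x -> graded k (- x).
Proof.
case=> n [p [xp pk]]; exists n, (- p); rewrite mulNr xp tofracN; split=> // i.
by rewrite coefN oppr_eq0 => /pk.
Qed.

Lemma gradedM k l x y : graded k x -> graded l y -> graded (k + l) (x * y).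
Proof.
case=> n [p [xp pk]] [m [q [yq qk]]].
exists (n + m)%N, (p * q); rewrite tofracM -xp -yq mulnDr exprD; split; first by ring.
move=> i; rewrite coefM => nz.
have [j nzj] : exists j : 'I_i.+1, p`_j * q`_(i - j) != 0.
  apply/existsP; apply: contraNT nz; rewrite negb_exists => /forallP z.
  by rewrite big1 // => j _; apply/eqP/negPn/z.
move: nzj; rewrite mulf_eq0 negb_or => /andP[/pk pj /qk qj].
have := ltn_ord j; lia.
Qed.

Lemma graded1 : graded 0 1.
Proof.
exists 0, 1; rewrite mul1r expr0 tofrac1; split=> // i.
by rewrite coef1; case: i.
Qed.

Lemma gradedX k x n : graded k x -> graded (k * n) (x ^+ n).
Proof.
move=> xk; elim: n => [|n IHn]; first by rewrite muln0 expr0; apply: graded1.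
by rewrite exprS mulnS; apply: gradedM.
Qed.

Lemma graded_sum k (I : Type) (r : seq I) (P : pred I) F :
  (forall i, P i -> graded k (F i)) -> graded k (\sum_(i <- r | P i) F i).
Proof.
move=> Fk; apply: big_rec => [|i x Pi]; first exact: graded0.
by apply: gradedD; apply: Fk.
Qed.

Lemma graded_varA : graded 1 varA.
Proof.
exists 0, 'X; rewrite muln0 expr0 mulr1; split=> // i.
by rewrite coefX; case: (i =P 1%N) => [->|_] //; rewrite eqxx.
Qed.

(** The residue 3 is -1 modulo 4, as [A ^-1 = A ^ 3 / A ^ 4]. *)
Lemma graded_varAV : graded 3 varA^-1.
Proof.
exists 1, 'X^3; rewrite tofracXn; split.
  by rewrite muln1 [in LHS]exprS mulKf ?varA_neq0.
by move=> i; rewrite coefXn; case: (i =P 3%N) => [->|_] //; rewrite eqxx.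
Qed.

Lemma graded_loop_value : graded 2 loop_value.
Proof.
apply: gradedD; apply: gradedN.
  exact: graded_mod (gradedX 2 graded_varA).
by rewrite -exprVn; apply: graded_mod (gradedX 2 graded_varAV).
Qed.

Lemma loop_value_neq0 : loop_value != 0.
Proof.
rewrite /loop_value -opprD oppr_eq0.
have A2 : varA ^+ 2 != 0 by rewrite expf_neq0 ?varA_neq0.
(* Up to sign, [A ^ 2] times the loop value is [A ^ 4 + 1], whose constant coefficient is 1. *)
rewrite -(inj_eq (mulfI A2)) mulrDr mulfV // mulr0 -exprD.
rewrite -tofracXn -tofrac1 -tofracD tofrac_eq0.
by apply/eqP => /(congr1 (fun p : {poly int} => p`_0)); rewrite coefD coefXn coef1 coef0.
Qed.

(* Comparing the leading coefficients, if both x and y are nonzero then l is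
   congruent to k as well as to k + 2. *)
Lemma graded_indep k l x y :
  graded k x -> graded (k + 2) y -> graded l (x + y) -> x = 0 \/ y = 0.
Proof.
case=> n [p [xp pk]] [m [q [yq qk]]] [h [r [zr rl]]].
pose N := (n + m + h)%N.
have [|p' [{}xp {}pk]] := @gradedP k n N _ _ xp pk; first by lia.
have [|q' [{}yq {}qk]] := @gradedP (k + 2) m N _ _ yq qk; first by lia.
have [|r' [{}zr {}rl]] := @gradedP l h N _ _ zr rl; first by lia.
have AN : varA ^+ (4 * N) != 0 by rewrite expf_neq0 ?varA_neq0.
have def_r : r' = p' + q'.
  by apply/eqP; rewrite -tofrac_eq tofracD -xp -yq -zr mulrDl.
have [p0 | nzp] := eqVneq p' 0.
  by left; apply: (mulIf AN); rewrite mul0r xp p0 tofrac0.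
have [q0 | nzq] := eqVneq q' 0.
  by right; apply: (mulIf AN); rewrite mul0r yq q0 tofrac0.
have nzlp := nzp; rewrite -lead_coef_eq0 lead_coefE in nzlp.
have nzlq := nzq; rewrite -lead_coef_eq0 lead_coefE in nzlq.
have := pk _ nzlp; have := qk _ nzlq.
set i := (size p').-1 in nzlp *; set j := (size q').-1 in nzlq * => jk ik.
have qi : q'`_i = 0 by apply/eqP/negPn/negP=> /qk; lia.
have pj : p'`_j = 0 by apply/eqP/negPn/negP=> /pk; lia.
have := rl i; rewrite def_r coefD qi addr0 => /(_ nzlp) il.
have := rl j; rewrite def_r coefD pj add0r => /(_ nzlq) jl.
lia.
Qed.

(** * Planar maps are two-colourable *)

Section ConnectMatrix.
Variables (F : fieldType) (T : finType) (e : rel T).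
Hypothesis e_sym : connect_sym e.

(** Row x is the indicator function of the component of x. Repeating a row for each element of its
    component keeps the matrix square, without a choice of representatives. *)
Definition connect_mx : 'M[F]_#|T| :=
  \matrix_(i, j) (connect e (enum_val i) (enum_val j))%:R.

Lemma connect_mxP m (A : 'M[F]_(m, #|T|)) :
  reflect (forall i x y, e x y -> A i (enum_rank x) = A i (enum_rank y))
          (A <= connect_mx)%MS.
Proof.
apply: (iffP idP) => [/submxP[B ->] i x y exy | Ae].
  rewrite !mxE; apply: eq_bigr => k _; rewrite !mxE !enum_rankK.
  by congr (_ * (nat_of_bool _)%:R); rewrite (same_connect_r e_sym (connect1 exy)).
have Ac i x y : connect e x y -> A i (enum_rank x) = A i (enum_rank y).
  case/connectP=> p; elim: p x => [|z p IHp] x /= => [_ -> // | /andP[/Ae -> ep]].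
  exact: IHp.
(* An invariant function is the combination of the rows at the roots whose coefficients are its
   values there. *)
pose B : 'M[F]_(m, #|T|) :=
  \matrix_(i, k) ((enum_val k \in roots e)%:R * A i k).
apply/submxP; exists B; apply/matrixP=> i j; rewrite !mxE.
rewrite (bigD1 (enum_rank (fingraph.root e (enum_val j)))) //= !mxE !enum_rankK.
rewrite big1 => [|k nk].
  have -> : fingraph.root e (enum_val j) \in roots e by apply: roots_root.
  rewrite e_sym connect_root mul1r mulr1 addr0.
  by rewrite -(Ac i _ _ (connect_root e (enum_val j))) enum_valK.
rewrite !mxE; case: (boolP (enum_val k \in roots e)) => [/eqP rk|_].
  case: (boolP (connect _ _ _)) => [/(fingraph.rootP e_sym) kj|_].
    by case/eqP: nk; rewrite -kj rk enum_valK.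
  by rewrite mulr0.
by rewrite !mul0r.
Qed.

(** The rows at the roots form a matrix [A] with the same row space, and these rows are independent:
    evaluation at the roots, the matrix [B], is a right inverse of [A]. *)
Lemma rank_connect_mx : \rank connect_mx = n_comp e T.
Proof.
pose A : 'M[F]_(#|roots e|, #|T|) :=
  \matrix_(k, j) (connect e (enum_val k) (enum_val j))%:R.
pose B : 'M[F]_(#|T|, #|roots e|) :=
  \matrix_(i, k) (enum_val i == enum_val k)%:R.
have AB : A *m B = 1%:M.
  apply/matrixP=> k l; rewrite !mxE.
  rewrite (bigD1 (enum_rank (enum_val l))) //= !mxE !enum_rankK eqxx mulr1.
  rewrite big1 ?addr0 => [|i ni].
    congr (nat_of_bool _)%:R; rewrite -(root_connect e_sym).
    have /eqP-> := enum_valP k; have /eqP-> := enum_valP l.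
    by rewrite (inj_eq enum_val_inj).
  rewrite !mxE; case: eqP => [il|]; last by rewrite mulr0.
  by case/eqP: ni; rewrite -il enum_valK.
have rA : \rank A = #|roots e|.
  apply/eqP; rewrite eqn_leq rank_leq_row /=.
  by rewrite -[X in (X <= _)%N](mxrank1 F #|roots e|) -AB mxrankM_maxl.
have -> : n_comp e T = #|roots e|.
  by rewrite /n_comp_mem; apply: eq_card => x; rewrite !inE andbT.
rewrite -rA; apply/eqP; rewrite eqn_leq; apply/andP; split; apply: mxrankS.
  apply/submxP; exists (\matrix_(i, k) (connect e (enum_val i) (enum_val k))%:R).
  apply/matrixP=> i j; rewrite !mxE.
  have rj : fingraph.root e (enum_val j) \in roots e by apply: roots_root.
  rewrite (bigD1 (enum_rank_in rj (fingraph.root e (enum_val j)))) //= big1 => [|k nk].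
    rewrite !mxE addr0 enum_rankK_in // [connect e (fingraph.root e _) _]e_sym connect_root mulr1.
    by rewrite (same_connect_r e_sym (connect_root e _)).
  rewrite !mxE; case: (connect e (enum_val k) _) / idP => [kj|]; last by rewrite mulr0.
  case/eqP: nk; apply: enum_val_inj; rewrite enum_rankK_in //.
  rewrite -(fingraph.rootP e_sym kj); exact/esym/eqP/(enum_valP k).
apply/submxP; exists B^T; apply/matrixP=> k j; rewrite !mxE.
rewrite (bigD1 (enum_rank (enum_val k))) //= !mxE enum_rankK eqxx mul1r.
rewrite big1 ?addr0 // => i ni; rewrite !mxE; case: eqP => [ik|]; last by rewrite mul0r.
by case/eqP: ni; rewrite -ik enum_valK.
Qed.

End ConnectMatrix.

Section Darts.
Variable D : prediagram.
Implicit Types (d e : dart D) (S : {set crossing D}).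

Lemma rot4_4 d : rot4 (rot4 (rot4 (rot4 d))) = d.
Proof.
by case: d => x [[|[|[|[|i]]]] lt_i]; congr pair; apply: val_inj.
Qed.

Lemma straightK : involutive (@straight D).
Proof. exact: rot4_4. Qed.

Lemma over_rot4 d : over (rot4 d) = ~~ over d.
Proof. by case: d => x [[|[|[|[|i]]]] lt_i]. Qed.

Lemma rot4_inj : injective (@rot4 D).
Proof. by apply: (can_inj (g := fun d => rot4 (rot4 (rot4 d)))) => d; apply: rot4_4. Qed.

Lemma rot4_uniq d : uniq [:: d; rot4 d; rot4 (rot4 d); rot4 (rot4 (rot4 d))].
Proof. by case: d => x [[|[|[|[|i]]]] lt_i]; rewrite /= !inE !xpair_eqE !eqxx. Qed.

Lemma dart_rot4 d e : e.1 = d.1 ->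
  e \in [:: d; rot4 d; rot4 (rot4 d); rot4 (rot4 (rot4 d))].
Proof.
by case: d e => x [[|[|[|[|i]]]] lt_i] [y [[|[|[|[|j]]]] lt_j]] //= ->;
   rewrite !inE !xpair_eqE !eqxx.
Qed.

Lemma mate_inj : injective (@mate D).
Proof. exact: inv_inj (@mateK D). Qed.

Lemma face_inj : injective (@face D).
Proof. by move=> d e /rot4_inj/mate_inj. Qed.

Lemma face_mate d : face (mate d) = rot4 d.
Proof. by rewrite /face mateK. Qed.

Lemma card_dart : #|{: dart D}| = (4 * #|crossing D|)%N.
Proof. by rewrite card_prod card_ord mulnC. Qed.

Lemma fcard_rot4 : fcard (@rot4 D) {: dart D} = #|crossing D|.
Proof.
apply/eqP; rewrite -(eqn_pmul2r (isT : 0 < 4)%N) [X in _ == X]mulnC -card_dart.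
rewrite (fcard_order_set rot4_inj) //; apply/subsetP=> d _; rewrite inE.
apply/eqP; apply: order_cycle (rot4_uniq d) _ _; last by rewrite inE eqxx.
by rewrite /= rot4_4 !eqxx.
Qed.

Lemma fcard_mate : fcard (@mate D) {: dart D} = (2 * #|crossing D|)%N.
Proof.
apply/eqP; rewrite -(eqn_pmul2r (isT : 0 < 2)%N).
rewrite (fcard_order_set mate_inj) //; first by rewrite card_dart; apply/eqP; lia.
apply/subsetP=> d _; rewrite inE.
apply/eqP; apply: (@order_cycle _ _ [:: d; mate d]); last by rewrite inE eqxx.
  by rewrite /= mateK !eqxx.
by rewrite /= inE eq_sym mate_neq.
Qed.

Lemma graph_sym : connect_sym (@graph_rel D).
Proof.
have e : @graph_rel D =2 relU (frel (@mate D)) (frel (@rot4 D)).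
  by move=> x y; congr (_ || _); apply: eq_sym.
move=> x y; rewrite !(eq_connect e).
exact: relU_sym (fconnect_sym mate_inj) (fconnect_sym rot4_inj) x y.
Qed.

Section Coloring.
Hypothesis D_planar : planar D.
Local Notation T := (dart D).
Local Notation n := #|{: T}|.
Local Notation M e := (@connect_mx 'F_2 T e).
Local Notation Mface := (M (frel (@face D))).
Local Notation Mmate := (M (frel (@mate D))).
Local Notation Mrot := (M (frel (@rot4 D))).

(** This compares the two sides of an edge. A checkerboard colouring is a function invariant under
    [face], that is, a colouring of the faces, which [Q] sends to the constant 1. *)
Let Q : 'M['F_2]_n :=
  \matrix_(i, j) ((i == j)%:R + (enum_val i == mate (enum_val j))%:R).

Lemma mulmxQ m (A : 'M_(m, n)) i d :
  (A *m Q) i (enum_rank d) = A i (enum_rank d) + A i (enum_rank (mate d)).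
Proof.
rewrite !mxE; under eq_bigr => k _ do rewrite !mxE mulrDr enum_rankK.
rewrite big_split /=; congr (_ + _).
  rewrite (bigD1 (enum_rank d)) //= eqxx mulr1 big1 ?addr0 // => k /negPf->.
  by rewrite mulr0.
rewrite (bigD1 (enum_rank (mate d))) //= enum_rankK eqxx mulr1.
rewrite big1 ?addr0 // => k nk; case: eqP => [kd|_]; last by rewrite mulr0.
by case/eqP: nk; rewrite -kd enum_valK.
Qed.

Lemma F2_addrr (a : 'F_2) : a + a = 0.
Proof. by case: a => [[|[|a]]] ?; apply: val_inj. Qed.

(** All the orthogonality relations below are obtained by writing the summand as a difference
    [u + u o f]. *)
Lemma F2_sum0 (f : T -> T) (u w : T -> 'F_2) : bijective f ->
    (forall d, w d = u d + u (f d)) ->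
  \sum_d w d = 0.
Proof.
move=> bij_f def_w; under eq_bigr => d _ do rewrite def_w.
have uf : \sum_d u d = \sum_d u (f d) by apply: reindex; apply: onW_bij.
by rewrite big_split /= -uf F2_addrr.
Qed.

Lemma mulmx_trE m1 m2 (A : 'M['F_2]_(m1, n)) (B : 'M_(m2, n)) i j :
  (A *m B^T) i j = \sum_d A i (enum_rank d) * B j (enum_rank d).
Proof.
rewrite mxE (reindex (@enum_rank T)) /=; last exact: onW_bij (enum_rank_bij _).
by apply: eq_bigr => d _; rewrite !mxE.
Qed.

Lemma connect_mx_inv (f : T -> T) (inj_f : injective f) i d :
  M (frel f) i (enum_rank (f d)) = M (frel f) i (enum_rank d).
Proof.
have /(connect_mxP (fconnect_sym inj_f)) Mf := submx_refl (M (frel f)).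
by apply/esym/Mf; apply: eqxx.
Qed.

Let bij_mate : bijective (@mate D).
Proof. exact: injF_bij mate_inj. Qed.
Let bij_rot4 : bijective (@rot4 D).
Proof. exact: injF_bij rot4_inj. Qed.

(* By duality over F_2: both the constant 1 and the functions c + c o mate, for
   c invariant under [face], are orthogonal to the functions invariant under
   [rot4] or under [mate].  By Euler's formula, the dimension of the space of
   the functions c + c o mate is that of the whole orthogonal, so that it
   contains 1. *)
Lemma checkerboard_coloring :
  exists c : T -> bool,
    (forall d, c (mate d) = ~~ c d) /\ (forall d, c (rot4 d) = ~~ c d).
Proof.
have fS := fconnect_sym face_inj; have mS := fconnect_sym mate_inj.
have rS := fconnect_sym rot4_inj.
have rkf := rank_connect_mx 'F_2 fS.
have rkm : \rank Mmate = (2 * #|crossing D|)%N.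
  by rewrite (rank_connect_mx _ mS) fcard_mate.
have rkr : \rank Mrot = #|crossing D| by rewrite (rank_connect_mx _ rS) fcard_rot4.
have rkg := rank_connect_mx 'F_2 graph_sym.
(* A function invariant under two of [rot4], [mate] and [face] is constant on the components of the
   map, which bounds the intersections. *)
have capg (A B : 'M['F_2]_n) :
    (forall m (C : 'M_(m, n)), (C <= A)%MS -> (C <= B)%MS ->
       forall i d, C i (enum_rank (mate d)) = C i (enum_rank d) /\
                   C i (enum_rank (rot4 d)) = C i (enum_rank d)) ->
    (\rank (A :&: B)%MS <= n_comp (@graph_rel D) {: T})%N.
  move=> AB; rewrite -rkg; apply/mxrankS/(connect_mxP graph_sym) => i x y.
  have [] := AB _ _ (capmxSl A B) (capmxSr A B) i x.
  by move=> m r /orP[]/eqP->.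
have rk1 : (\rank (Mrot :&: Mmate)%MS <= n_comp (@graph_rel D) {: T})%N.
  apply: capg => m C /(connect_mxP rS) Cr /(connect_mxP mS) Cm i d.
  by split; [apply/esym/Cm | apply/esym/Cr]; rewrite /= eqxx.
have rk2 : (\rank (Mface :&: kermx Q)%MS <= n_comp (@graph_rel D) {: T})%N.
  apply: capg => m C /(connect_mxP fS) Cf /sub_kermxP CQ i d.
  have Cm d' : C i (enum_rank (mate d')) = C i (enum_rank d').
    have /(congr1 (+%R (C i (enum_rank d')))) := mulmxQ C i d'.
    by rewrite CQ mxE addrA F2_addrr add0r addr0.
  split=> //; rewrite -face_mate -[RHS]Cm; apply/esym/Cf; exact: eqxx.
pose one : 'rV['F_2]_n := const_mx 1.
have Z m (A : 'M_(m, n)) : (Mrot *m A^T = 0) -> (Mmate *m A^T = 0) ->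
  A *m (Mrot + Mmate)%MS^T = 0.
  move=> /sub_kermxP Ar /sub_kermxP Am; apply: trmx_inj.
  by rewrite trmx_mul trmxK trmx0; apply/sub_kermxP; rewrite addsmx_sub Ar.
(* The constant 1 is a difference for both maps: [over] alternates around a crossing, and [o]
   selects one end of each edge. *)
have Z1 : one *m (Mrot + Mmate)%MS^T = 0.
  apply: Z; apply/matrixP=> i j; rewrite mulmx_trE [RHS]mxE.
    apply: (F2_sum0 (f := @rot4 D) (u := fun d => (over d)%:R * Mrot i (enum_rank d))) => // d.
    rewrite over_rot4 connect_mx_inv; last exact: rot4_inj.
    by rewrite -mulrDl mulrC mxE; case: over; rewrite /= ?addr0 ?add0r.
  pose o (d : T) := (enum_rank d < enum_rank (mate d))%N.
  apply: (F2_sum0 (f := @mate D) (u := fun d => (o d)%:R * Mmate i (enum_rank d))) => // d.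
  rewrite connect_mx_inv; last exact: mate_inj.
  rewrite -mulrDl mulrC mxE /o mateK.
  case: ltngtP => [||/val_inj/enum_rank_inj/eqP]; rewrite /= ?addr0 ?add0r //.
  by rewrite eq_sym (negPf (mate_neq d)).
(* For c invariant under [face], c + c o [mate] is also c + c o [rot4], because
   [face (mate d) = rot4 d]. *)
have Zf : (Mface *m Q) *m (Mrot + Mmate)%MS^T = 0.
  apply: Z; apply/matrixP=> i j; rewrite mulmx_trE [RHS]mxE.
    apply: (F2_sum0 (f := @rot4 D)
        (u := fun d => Mface j (enum_rank d) * Mrot i (enum_rank d))) => // d.
    rewrite connect_mx_inv; last exact: rot4_inj.
    rewrite mulmxQ -mulrDl mulrC; congr ((_ + _) * _).
    by rewrite -face_mate connect_mx_inv //; apply: face_inj.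
  apply: (F2_sum0 (f := @mate D)
      (u := fun d => Mface j (enum_rank d) * Mmate i (enum_rank d))) => // d.
  rewrite connect_mx_inv; last exact: mate_inj.
  by rewrite mulmxQ -mulrDl mulrC.
(* With V crossings, F faces and C components, the orthogonal has dimension at most 4V - (3V - C) =
   V + C, while the image of [Q] has dimension at least F - C, which is V + C by Euler's formula. *)
have one_f : (one <= Mface *m Q)%MS.
  have /mulmx0_rank_max le_n : (Mface *m Q + one)%MS *m (Mrot + Mmate)%MS^T = 0.
    apply: trmx_inj; rewrite trmx_mul trmxK trmx0.
    apply: trmx_inj; rewrite trmx_mul trmxK trmx0.
    by apply/sub_kermxP; rewrite addsmx_sub; apply/andP; split; apply/sub_kermxP.
  have sub : (Mface *m Q <= Mface *m Q + one)%MS by apply: addsmxSl.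
  apply: submx_trans (addsmxSr (Mface *m Q) one) _.
  rewrite -(mxrank_leqif_sup sub).2.
  have := mxrank_mul_ker Mface Q; have := mxrank_sum_cap Mrot Mmate.
  rewrite mxrank_tr [X in (_ <= X)%N]card_dart in le_n.
  move: (eqP D_planar) le_n (mxrankS sub) rkf rkm rkr rk1 rk2.
  move: (\rank _) (\rank _) (\rank _) (\rank _) (\rank _) (\rank _) (\rank _).
  move: (\rank _) (n_comp _ _) (fcard _ _) => *; lia.
case/submxP: one_f => B one_B.
pose c := B *m Mface.
have cf : (c <= Mface)%MS by apply: submxMl.
have cm d : c 0 (enum_rank d) + c 0 (enum_rank (mate d)) = 1.
  by rewrite -mulmxQ /c -mulmxA -one_B mxE.
have F2 (a b : 'F_2) : a + b = 1 -> (b == 1) = ~~ (a == 1).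
  by case: a b => [[|[|a]] ?] [[|[|b]] ?].
exists (fun d => c 0 (enum_rank d) == 1); split=> d; first exact/F2/cm.
rewrite -face_mate.
have /(connect_mxP fS)/(_ 0 (mate d) (face (mate d)) (eqxx _)) <- := cf.
exact/F2/cm.
Qed.

End Coloring.
End Darts.

(** * Parity of the number of curves of a state *)

Local Open Scope nat_scope.

Lemma n_comp_roots (T : finType) (e : rel T) (a : {pred T}) :
  n_comp e a = #|[predI roots e & a]|.
Proof. by []. Qed.

Lemma card_porbits (T : finType) (s : {perm T}) : #|porbits s| = fcard s T.
Proof.
have sS := fconnect_sym (@perm_inj _ s).
have porbitE x y : (y \in porbit s x) = fconnect s x y.
  apply/porbitP/idP => [[i ->]|]; first by rewrite permX fconnect_iter.
  by move/iter_findex => <-; exists (findex s x y); rewrite permX.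
have -> : porbits s = porbit s @: [set x | x \in froots s].
  apply/setP=> A; apply/imsetP/imsetP => [[x _ ->]|[x _ ->]]; last by exists x.
  exists (froot s x); first by rewrite inE; apply: roots_root.
  by apply/eqP; rewrite eq_porbit_mem porbitE sS connect_root.
rewrite card_in_imset => [|x y]; last first.
  rewrite !inE => /eqP rx /eqP ry /eqP; rewrite eq_porbit_mem porbitE.
  by move/(fingraph.rootP sS); rewrite rx ry.
by rewrite n_comp_roots cardsE; apply: eq_card => x; rewrite !inE andbT.
Qed.

Lemma flip_setU1 (T : finType) (N : {set T} -> bool) (s : {set T}) :
    (forall (t : {set T}) x, x \notin t -> N (x |: t) = ~~ N t) ->
  N s = N set0 (+) odd #|s|.
Proof.
move=> flip; have [m] := ubnP #|s|; elim: m s => // m IHm s.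
have [->|[x xs]] := set_0Vmem s; first by rewrite cards0 addbF.
rewrite (cardsD1 x) xs => lt_s; rewrite -[in LHS](setD1K xs) flip ?setD11 //.
by rewrite IHm // addbN.
Qed.

Section Smoothing.
Variable D : prediagram.
Implicit Types (d e : dart D) (s : {set crossing D}).

(** The components are the closed curves which follow the edges and cross the vertices according to
    [j]: one relation for smoothings, straight passages and mixtures of them. *)
Definition step_rel (j : dart D -> dart D) : rel (dart D) :=
  [rel d e | (e == mate d) || (e == j d)].

Lemma step_sym j : involutive j -> connect_sym (step_rel j).
Proof.
move=> jK; apply: sym_connect_sym => d e /=.
by congr (_ || _); apply/eqP/eqP => ->; rewrite ?mateK ?jK.
Qed.

Lemma step_mate j d : step_rel j d (mate d).
Proof. by rewrite /step_rel /= eqxx. Qed.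

Lemma step_join j d : step_rel j d (j d).
Proof. by rewrite /step_rel /= eqxx orbT. Qed.

(** A description by [rot4] and [over] alone is transported by [compatible] maps, which may change
    the indices of the darts around a crossing. *)
Lemma smooth_rot4 s d :
  smooth s d = if (d.1 \in s) == over d then straight (rot4 d) else rot4 d.
Proof.
case: d => x [[|[|[|[|i]]]] lt_i]; rewrite /smooth /over /=; case: (x \in s) => //=;
  by apply/eqP; rewrite xpair_eqE eqxx.
Qed.

Lemma smooth1 s d : (smooth s d).1 = d.1. Proof. by []. Qed.

Lemma smoothK s : involutive (smooth s).
Proof.
case=> x [[|[|[|[|i]]]] lt_i]; rewrite /smooth /=; case: (x \in s) => //=;
  by apply/eqP; rewrite xpair_eqE eqxx.
Qed.

Section Parity.
Variable c : dart D -> bool.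
Hypothesis c_mate : forall d, c (mate d) = ~~ c d.
Hypothesis c_rot4 : forall d, c (rot4 d) = ~~ c d.

Lemma c_smooth s d : c (smooth s d) = ~~ c d.
Proof. by rewrite smooth_rot4; case: ifP; rewrite /straight !c_rot4 ?negbK. Qed.

Lemma c_straight d : c (straight d) = c d.
Proof. by rewrite /straight !c_rot4 negbK. Qed.

(* Coloured darts orient the curves of a state: on these, following the curve
   is a permutation, which has as many orbits as the state has curves. *)
Definition walk_fun s d := if c d then smooth s (mate d) else d.

Lemma c_walk s d : c (walk_fun s d) = c d.
Proof. by rewrite /walk_fun; case cd: (c d); rewrite // c_smooth c_mate cd. Qed.

Lemma walk_inj s : injective (walk_fun s).
Proof.
move=> d e eq_de; have := congr1 c eq_de; rewrite !c_walk => cde.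
move: eq_de; rewrite /walk_fun cde; case: (c e) => //.
by move/(inv_inj (smoothK s))/mate_inj.
Qed.

Definition walk s : {perm dart D} := perm (@walk_inj s).

(** The two coloured darts at x are opposite, and the two smoothings send the uncoloured darts of x
    to them in the two possible ways. *)
Lemma walk_setU1 s x (p : dart D) : x \notin s -> p.1 = x -> c p ->
  walk (x |: s) = (walk s * tperm p (straight p))%g.
Proof.
move=> xs px cp; apply/permP=> d; rewrite permM ![walk _ _]permE /walk_fun.
case cd: (c d); last first.
  by rewrite tpermD //; apply: contraFneq cd => <-; rewrite ?c_straight.
have [mx|nmx] := eqVneq (mate d).1 x; last first.
  rewrite tpermD; first by rewrite !smooth_rot4 in_setU1 (negPf nmx).
    by rewrite eq_sym; apply: contraNneq nmx => /(congr1 fst); rewrite smooth1 px => ->.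
  by rewrite eq_sym; apply: contraNneq nmx => /(congr1 fst); rewrite smooth1 => ->; rewrite -px.
rewrite !smooth_rot4 mx setU11 (negPf xs).
have cm : c (mate d) = false by rewrite c_mate cd.
have := @dart_rot4 _ (mate d) p; rewrite px mx => /(_ erefl); rewrite !inE.
case/or4P => /eqP p_eq.
- by move: cp; rewrite p_eq cm.
- by rewrite p_eq; case: over; rewrite /= ?tpermL ?tpermR.
- by move: cp; rewrite p_eq !c_rot4 cm.
- rewrite p_eq; case: over; rewrite /= /straight ?rot4_4 ?tpermL ?tpermR //.
Qed.

Lemma odd_porbits_walk s x : x \notin s ->
  odd #|porbits (walk (x |: s))| = ~~ odd #|porbits (walk s)|.
Proof.
move=> xs.
have [p px cp] : exists2 p : dart D, p.1 = x & c p.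
  case cx: (c (x, ord0)); first by exists (x, ord0).
  by exists (rot4 (x, ord0)); rewrite // c_rot4 cx.
have := congr1 (@odd_perm _) (walk_setU1 xs px cp).
rewrite odd_permM odd_tperm /odd_perm.
have -> : p != straight p.
  by have := rot4_uniq p; rewrite /= !inE !negb_or => /andP[/and3P[]].
by case: (odd #|_|) => /=; do 2 case: (odd _).
Qed.

(** Colours alternate along a curve, so its coloured darts form exactly one orbit. The uncoloured
    darts are fixed points, in a number independent of the state, hence harmless for comparing
    parities. *)
Lemma card_porbits_walk s :
  #|porbits (walk s)|
    = (n_comp (step_rel (smooth s)) {: dart D} + #|[predC c]|)%N.
Proof.
rewrite card_porbits (n_compC c).
have wS := fconnect_sym (@perm_inj _ (walk s)).
have wc : fclosed (walk s) c.
  by move=> d _ /eqP <-; rewrite permE [in RHS]unfold_in c_walk.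
congr (_ + _)%N; last first.
  rewrite n_comp_roots; apply: eq_card => d; rewrite !inE.
  case: (boolP (d \in c)) => [_|cd]; rewrite ?andbF // andbT.
  have fix_d : walk s d = d by rewrite permE /walk_fun; move: cd; rewrite unfold_in => /negPf->.
  rewrite /roots /=; have := connect_root (frel (walk s)) d.
  rewrite fconnect_orbit /fingraph.orbit.
  suff E n : traject (walk s) d n = nseq n d by rewrite E mem_nseq => /andP[].
  by elim: n => //= n <-; rewrite fix_d.
(* Moving to the coloured end of the edge gives an adjunction between curves and orbits of coloured
   darts. *)
pose h d := if c d then d else mate d.
rewrite (adjunction_n_comp h wS (step_sym (smoothK s)) wc).
  by apply: eq_n_comp_r => d; rewrite !inE /h unfold_in; case: ifP => //; rewrite c_mate => ->.
have hc d : c (h d) by rewrite /h; case: ifP => // cd; rewrite c_mate cd.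
split=> [d cd|d e _]; first by exists d; rewrite /h (cd : c d).
have step1 d' : connect (step_rel (smooth s)) d' (h d').
  by rewrite /h; case: ifP => [_|_]; [apply: connect0 | apply: connect1 (step_mate _ _)].
have sS := step_sym (smoothK s).
apply/idP/idP=> [/connectP[p]|].
  elim: p d => [|e' p IHp] d' /=; first by move=> _ ->.
  case/andP=> de ep /(IHp _ ep); apply: connect_trans; case/orP: de => /eqP->.
    by rewrite /h c_mate; case: (c d'); rewrite ?mateK.
  rewrite /h c_smooth; case cd': (c d') => /=.
    rewrite wS connect1 //= permE /walk_fun c_mate c_smooth cd' mateK.
    by rewrite smoothK.
  by rewrite connect1 //= permE /walk_fun c_mate cd' mateK.
have sub : subrel (frel (walk s)) (connect (step_rel (smooth s))).
  move=> d' _ /eqP<-; rewrite permE /walk_fun; case: (c d') => //.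
  by apply: connect_trans (connect1 (step_mate _ _)) (connect1 (step_join _ _)).
move/(connect_sub sub) => hde.
apply: connect_trans (step1 d) (connect_trans hde _).
by rewrite sS.
Qed.

Lemma odd_state_loops s :
  odd (n_comp (step_rel (smooth s)) {: dart D})
    = odd (n_comp (step_rel (smooth set0)) {: dart D}) (+) odd #|s|.
Proof.
have step (t : {set crossing D}) x : x \notin t ->
    odd (n_comp (step_rel (smooth (x |: t))) {: dart D})
      = ~~ odd (n_comp (step_rel (smooth t)) {: dart D}).
  move=> xt; have E1 := congr1 odd (card_porbits_walk (x |: t)).
  have E2 := congr1 odd (card_porbits_walk t).
  have := etrans (esym E1) (etrans (odd_porbits_walk xt) (congr1 negb E2)).
  have negb_addb (p q r : bool) : p (+) r = ~~ (q (+) r) -> p = ~~ q.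
    by case: p q r => [] [] [].
  by rewrite [LHS]oddD [X in _ = ~~ X]oddD => /negb_addb.
exact: (flip_setU1 (N := fun t => odd (n_comp (step_rel (smooth t)) {: dart D})) s step).
Qed.

End Parity.
End Smoothing.

(** * The bracket of a classical diagram and of a diagram with one virtual crossing *)

Local Open Scope ring_scope.

Definition state_weight (X : finType) (C s : {set X}) : ratfun :=
  varA ^+ #|s| * varA ^- #|C :\: s|.

(** The loop count is an arbitrary function [L], so that the comparison of two diagrams takes place
    between functions of the subsets of one set of crossings. *)
Definition state_sum (X : finType) (C : {set X}) (L : {set X} -> nat) : ratfun :=
  \sum_(s : {set X} | s \subset C) state_weight C s * loop_value ^+ L s.

Definition full_smooth (D : prediagram) (s : {set crossing D}) (d : dart D) :=
  if virtual d.1 then straight d else smooth s d.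

Definition loops (D : prediagram) (j : dart D -> dart D) : nat :=
  (circles D + n_comp (step_rel j) {: dart D})%N.

(** Unnormalised: a single circle has value d. *)
Definition bracket (D : prediagram) : ratfun :=
  state_sum (classical_crossings D) (fun s => loops (full_smooth s)).

(** Modulo 4 the exponents are |s| + 3 (|C| - |s|) + 2 L, that is, 3 |C| + 2 (|s| + L). *)
Lemma graded_state (X : finType) (C s : {set X}) L (b : bool) :
    s \subset C -> odd (#|s| + L) = b ->
  graded (3 * #|C| + 2 * b) (state_weight C s * loop_value ^+ L).
Proof.
move=> sC Lb.
have sCn := cardsD C s; rewrite (setIidPr sC) in sCn.
have := subset_leq_card sC => le_sC.
rewrite /state_weight -exprVn.
apply: graded_mod (gradedM (gradedM (gradedX #|s| graded_varA)
  (gradedX #|C :\: s| graded_varAV)) (gradedX L graded_loop_value)).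
by rewrite sCn; move: Lb le_sC; move: #|s| #|C| => p q; case: b => /=; lia.
Qed.

Lemma connect_closed_sub (T : finType) (e e' : rel T) (a : {pred T}) x y :
    closed e a -> (forall x y, x \in a -> e x y -> e' x y) ->
  x \in a -> connect e x y -> connect e' x y.
Proof.
move=> ea ee' ax /connectP[p ep ->]; elim: p x ax ep => //= z p IHp x ax /andP[xz ep].
apply: connect_trans (connect1 (ee' _ _ ax xz)) (IHp _ _ ep).
by rewrite -(ea _ _ xz).
Qed.

Lemma eq_n_comp_closed (T : finType) (e e' : rel T) (a : {pred T}) :
    closed e a -> (forall x y, x \in a -> e x y = e' x y) ->
  n_comp e a = n_comp e' a.
Proof.
move=> ea ee'; rewrite !n_comp_roots; apply: eq_card => x.
rewrite !inE; case: (boolP (x \in a)) => ax; rewrite ?andbF // !andbT /roots /fingraph.root.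
have e'a : forall y z, y \in a -> e' y z -> z \in a.
  by move=> y z ay; rewrite -ee' // => yz; rewrite -(ea _ _ yz).
have E : connect e x =1 connect e' x.
  move=> y; apply/idP/idP; first by apply: connect_closed_sub ax => // ? ? ?; rewrite ee'.
  case/connectP=> p ep ->; elim: p x ax ep => //= z p IHp x ax /andP[xz ep].
  apply: connect_trans (connect1 _) (IHp _ (e'a _ _ ax xz) ep).
  by rewrite ee'.
by rewrite (eq_pick E).
Qed.

Lemma graded_classical (D : diagram) :
  no_virtual D -> exists k, graded k (bracket D).
Proof.
move=> cl; have [c [cm cr]] := checkerboard_coloring (diagram_planar D).
pose b := odd (circles D) (+) odd (n_comp (step_rel (smooth set0)) {: dart D}).
exists (3 * #|classical_crossings D| + 2 * b)%N; apply: graded_sum => s sC.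
apply: graded_state => //; rewrite /loops.
have -> : n_comp (step_rel (full_smooth s)) {: dart D}
          = n_comp (step_rel (smooth s)) {: dart D}.
  by apply: eq_n_comp_closed => // d e _; rewrite /step_rel /full_smooth /= (negPf (cl _)).
rewrite !oddD (odd_state_loops cm cr) /b.
by case: (odd #|s|); case: (odd (circles D)); case: (odd _).
Qed.

Section OneVirtual.
Variables (K : diagram) (v : crossing K).
Hypothesis v_virtual : virtual v.
Hypothesis v_unique : forall x : crossing K, virtual x -> x = v.
Implicit Type s : {set crossing K}.

Lemma virtualE x : virtual x = (x == v).
Proof. by apply/idP/eqP => [/v_unique | ->]. Qed.

Lemma state_sym s : connect_sym (state_rel s).
Proof.
apply: sym_connect_sym => d e /=; congr (_ || _).
  by apply/eqP/eqP => ->; rewrite mateK.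
by apply/andP/andP => -[? /eqP de]; rewrite de smoothK /= eqxx -?de.
Qed.

(** The curves which avoid v are those counted by [state_loops], and the arcs ending at v are linked
    into a single further curve by the last hypothesis. *)
Lemma loops_ends s (j : dart K -> dart K) :
    involutive j -> (forall d, d.1 != v -> j d = smooth s d) ->
    (forall i, connect (step_rel j) (v, ord0) (v, i)) ->
  loops j = (state_loops s).+1.
Proof.
move=> jK js jv; rewrite /loops /state_loops -addnS; congr (_ + _)%N.
set a := [pred d | _]; have jS := step_sym jK.
have a_v d : d \in a -> d.1 != v.
  by rewrite inE => /forallP/(_ d); rewrite connect0 virtualE.
have ja d e : d \in a -> step_rel j d e = state_rel s d e.
  by move=> /a_v dv; rewrite /step_rel /state_rel /= virtualE dv js.
have cl : closed (step_rel j) a.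
  apply: (intro_closed jS) => d e de ad; have := de; rewrite ja // => /connect1 de'.
  move: ad; rewrite !inE => /forallP ad; apply/forallP=> z.
  by apply/implyP=> /(connect_trans de'); apply/implyP.
rewrite (n_compC a) (eq_n_comp_closed cl ja) -[RHS]addn1; congr (_ + _)%N.
apply: etrans (n_comp_connect jS (v, ord0)); apply: eq_n_comp_r => d.
suff: (d \in [predC a]) = connect (step_rel j) (v, ord0) d by []; apply/idP/idP.
  rewrite !inE negb_forall => /existsP[[x i]]; rewrite negb_imply negbK /= => /andP[dx].
  rewrite virtualE => /eqP xv; subst x; rewrite jS; apply: connect_trans (_ : connect _ d (v, i)) _.
    apply: connect_sub dx => d' e' /orP[/eqP->|/andP[nv /eqP->]].
      exact: connect1 (step_mate _ _).
    by rewrite -js -?virtualE //; apply: connect1 (step_join _ _).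
  by rewrite jS.
have nv : (v, ord0) \in [predC a] by rewrite inE; apply: contraL (eqxx v) => /a_v.
by move/(closed_connect (predC_closed cl)) <-.
Qed.

Section Ends.
Variable c : dart K -> bool.
Hypothesis c_mate : forall d, c (mate d) = ~~ c d.
Hypothesis c_rot4 : forall d, c (rot4 d) = ~~ c d.

(* On a curve of a state, [mate] exchanges the two colours, and [smooth] does
   so away from the ends: the ends are thus evenly coloured. *)
Lemma opposite_end s i :
  exists2 j, connect (state_rel s) (v, i) (v, j) & c (v, j) = ~~ c (v, i).
Proof.
pose C := [set d | connect (state_rel s) (v, i) d].
pose A b := [set d | (d \in C) && (c d == b)].
pose B b := [set d | (d \in A b) && (d.1 != v)].
have C_mate d : (mate d \in C) = (d \in C).
  rewrite !in_set; apply: (same_connect_r (state_sym s)).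
  by rewrite state_sym connect1 // /state_rel /= eqxx.
have C_smooth d : d.1 != v -> (smooth s d \in C) = (d \in C).
  move=> dv; rewrite !in_set; apply: (same_connect_r (state_sym s)).
  by rewrite state_sym connect1 // /state_rel /= virtualE dv eqxx orbT.
have cardA b : (#|A b| <= #|A (~~ b)|)%N.
  rewrite -(card_imset (mem (A b)) (@mate_inj K)); apply/subset_leq_card/subsetP.
  move=> _ /imsetP[d dA ->]; move: dA; rewrite ![_ \in A _]in_set C_mate c_mate.
  by case/andP=> -> /eqP->; rewrite /=.
have cardB b : (#|B b| <= #|B (~~ b)|)%N.
  rewrite -(card_imset (mem (B b)) (inv_inj (smoothK s))).
  apply/subset_leq_card/subsetP => _ /imsetP[d dB ->]; move: dB.
  rewrite ![_ \in B _]in_set ![_ \in A _]in_set smooth1 => /andP[/andP[dC /eqP cd] dv].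
  by rewrite C_smooth // dC dv (c_smooth c_rot4) cd eqxx.
have cardAB b : #|A b| = #|A (~~ b)| /\ #|B b| = #|B (~~ b)|.
  split; apply/eqP; rewrite eqn_leq; apply/andP; split=> //.
    by have := cardA (~~ b); rewrite negbK.
  by have := cardB (~~ b); rewrite negbK.
have BA b : B b \subset A b by apply/subsetP=> d; rewrite in_set => /andP[].
pose b := c (v, i); have [cA cB] := cardAB b.
have : (0 < #|A (~~ b) :\: B (~~ b)|)%N.
  rewrite cardsDS // -cA -cB -cardsDS // card_gt0; apply/set0Pn.
  by exists (v, i); rewrite in_setD [_ \in B b]in_set /= eqxx andbF
    [_ \in A b]in_set in_set connect0 eqxx.
rewrite card_gt0 => /set0Pn[[y j]]; rewrite in_setD [_ \in B _]in_set negb_and negbK.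
case/andP=> /orP[/negP//|/eqP /= ->]; rewrite !in_set => /andP[vj /eqP cj].
by exists j.
Qed.

Let o1 : 'I_4 := @Ordinal 4 1 isT.
Let o2 : 'I_4 := @Ordinal 4 2 isT.
Let o3 : 'I_4 := @Ordinal 4 3 isT.

Lemma ord4P (i : 'I_4) : [\/ i = ord0, i = o1, i = o2 | i = o3].
Proof.
by case: i => [[|[|[|[|i]]]] lt_i] //;
  [constructor 1 | constructor 2 | constructor 3 | constructor 4]; apply: val_inj.
Qed.

Lemma c_ends : [/\ c (v, o1) = ~~ c (v, ord0), c (v, o2) = c (v, ord0)
                 & c (v, o3) = ~~ c (v, ord0)].
Proof.
have <- : rot4 (v, ord0) = (v, o1) by congr pair; apply: val_inj.
have <- : straight (v, ord0) = (v, o2) by congr pair; apply: val_inj.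
have <- : straight (rot4 (v, ord0)) = (v, o3) by congr pair; apply: val_inj.
by rewrite /straight !c_rot4 !negbK.
Qed.

Lemma state_joins01 s : state_joins s v join01 =
  connect (state_rel s) (v, ord0) (v, o1) && connect (state_rel s) (v, o2) (v, o3).
Proof.
have j0 : join01 ord0 = o1 by apply: val_inj.
have j1 : join01 o1 = ord0 by apply: val_inj.
have j2 : join01 o2 = o3 by apply: val_inj.
have j3 : join01 o3 = o2 by apply: val_inj.
apply/forallP/andP=> [sj|[c01 c23] i].
  by split; [rewrite -j0 | rewrite -j2]; apply: sj.
by case: (ord4P i) => ->; rewrite ?j0 ?j1 ?j2 ?j3 // state_sym.
Qed.

Lemma state_joins12 s : state_joins s v join12 =
  connect (state_rel s) (v, o1) (v, o2) && connect (state_rel s) (v, o3) (v, ord0).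
Proof.
have j0 : join12 ord0 = o3 by apply: val_inj.
have j1 : join12 o1 = o2 by apply: val_inj.
have j2 : join12 o2 = o1 by apply: val_inj.
have j3 : join12 o3 = ord0 by apply: val_inj.
apply/forallP/andP=> [sj|[c01 c23] i].
  by split; [rewrite -j1 | rewrite -j3]; apply: sj.
by case: (ord4P i) => ->; rewrite ?j0 ?j1 ?j2 ?j3 // state_sym.
Qed.

Lemma smooth_setU1 s d : d.1 != v -> smooth (v |: s) d = smooth s d.
Proof. by move=> dv; rewrite /smooth in_setU1 (negPf dv). Qed.

Lemma smooth_end s i : smooth s (v, i) = (v, if v \in s then join01 i else join12 i).
Proof. by []. Qed.

Lemma odd_loops s : odd (loops (smooth s)) = odd (loops (@smooth K set0)) (+) odd #|s|.
Proof.
rewrite /loops [LHS]oddD (odd_state_loops c_mate c_rot4 s) addbA.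
by congr (_ (+) _); rewrite -oddD.
Qed.

Lemma connect_state_step s j d e : (forall d, d.1 != v -> j d = smooth s d) ->
  connect (state_rel s) d e -> connect (step_rel j) d e.
Proof.
move=> js; apply: connect_sub => {d e} d e /orP[/eqP->|/andP[nv /eqP->]].
  exact: connect1 (step_mate _ _).
by rewrite -js -?virtualE //; apply: connect1 (step_join _ _).
Qed.

Lemma full_smoothK (D : prediagram) (s : {set crossing D}) :
  involutive (full_smooth s).
Proof.
move=> d; rewrite /full_smooth; case vd: (virtual d.1) => /=; rewrite vd.
  exact: straightK.
exact: smoothK.
Qed.

Lemma full_smooth_off s d : d.1 != v -> full_smooth s d = smooth s d.
Proof. by rewrite /full_smooth virtualE => /negPf->. Qed.

(** A pairing at v other than the one realised by the state links the two arcs into one curve. As v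
    is not in s, [smooth s] pairs its darts by [join12]; the straight passage is the other such
    pairing. *)
Lemma loops01 s : v \notin s -> state_joins s v join01 ->
  loops (smooth s) = (state_loops s).+1 /\
  loops (full_smooth s) = (state_loops s).+1.
Proof.
move=> vs; rewrite state_joins01 => /andP[c01 c23].
split; apply: loops_ends.
- exact: smoothK.
- by [].
- have c12 : connect (step_rel (smooth s)) (v, o1) (v, o2).
    have -> : (v, o2) = smooth s (v, o1).
      by rewrite smooth_end (negPf vs); congr pair; apply: val_inj.
    exact: connect1 (step_join _ _).
  have c03 : connect (step_rel (smooth s)) (v, ord0) (v, o3).
    have -> : (v, o3) = smooth s (v, ord0).
      by rewrite smooth_end (negPf vs); congr pair; apply: val_inj.
    exact: connect1 (step_join _ _).
  have c01' := @connect_state_step s (smooth s) _ _ (fun _ _ => erefl) c01.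
  move=> i; case: (ord4P i) => -> //.
  exact: connect_trans c01' c12.
- exact: full_smoothK.
- exact: full_smooth_off.
- have c02 : connect (step_rel (full_smooth s)) (v, ord0) (v, o2).
    have -> : (v, o2) = full_smooth s (v, ord0).
      by rewrite /full_smooth /= v_virtual; congr pair; apply: val_inj.
    exact: connect1 (step_join _ _).
  have c01' := connect_state_step (@full_smooth_off s) c01.
  have c23' := connect_state_step (@full_smooth_off s) c23.
  move=> i; case: (ord4P i) => -> //.
  exact: connect_trans c02 c23'.
Qed.

(** Here the smoothing of v has to be [join01], so v is added to the state; this extra element
    separates the residues of the two coefficients. *)
Lemma loops12 s : v \notin s -> state_joins s v join12 ->
  loops (smooth (v |: s)) = (state_loops s).+1 /\
  loops (full_smooth s) = (state_loops s).+1.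
Proof.
move=> vs; rewrite state_joins12 => /andP[c12 c30].
have c03 : connect (state_rel s) (v, ord0) (v, o3) by rewrite state_sym.
split; apply: loops_ends.
- exact: smoothK.
- exact: smooth_setU1.
- have c01 : connect (step_rel (smooth (v |: s))) (v, ord0) (v, o1).
    have -> : (v, o1) = smooth (v |: s) (v, ord0).
      by rewrite smooth_end setU11; congr pair; apply: val_inj.
    exact: connect1 (step_join _ _).
  have c12' := connect_state_step (@smooth_setU1 s) c12.
  have c03' := connect_state_step (@smooth_setU1 s) c03.
  move=> i; case: (ord4P i) => -> //.
  exact: connect_trans c01 c12'.
- exact: full_smoothK.
- exact: full_smooth_off.
- have c02 : connect (step_rel (full_smooth s)) (v, ord0) (v, o2).
    have -> : (v, o2) = full_smooth s (v, ord0).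
      by rewrite /full_smooth /= v_virtual; congr pair; apply: val_inj.
    exact: connect1 (step_join _ _).
  have c12' := connect_state_step (@full_smooth_off s) c12.
  have c03' := connect_state_step (@full_smooth_off s) c03.
  move=> i; case: (ord4P i) => -> //.
  by apply: connect_trans c02 _; rewrite (step_sym (full_smoothK s)).
Qed.

(** Otherwise both smoothings of v would yield [(state_loops s).+1] curves, although they differ in
    parity. *)
Lemma ends_not_connected s : v \notin s ->
  ~ (forall i, connect (state_rel s) (v, ord0) (v, i)).
Proof.
move=> vs conn; have := odd_loops s; have := odd_loops (v |: s).
rewrite (@loops_ends s (smooth s)) ?(@loops_ends s (smooth (v |: s))) //.
- by rewrite cardsU1 vs /= addbN => -> /esym; case: (_ (+) _).
- exact: smoothK.
- exact: smooth_setU1.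
- by move=> i; apply: connect_state_step (@smooth_setU1 s) (conn i).
- exact: smoothK.
- by move=> i; apply: connect_state_step (conn i).
Qed.

(** Every end is connected to one of the opposite colour, hence to a neighbour. As the four ends are
    not all connected, only the two planar pairings remain. *)
Lemma state_joins_cases s : v \notin s ->
  state_joins s v join12 = ~~ state_joins s v join01.
Proof.
move=> vs; rewrite state_joins01 state_joins12.
have [c1 c2 c3] := c_ends.
pose E i j := connect (state_rel s) (v, i) (v, j).
have tr i j k : E i j -> E j k -> E i k by apply: connect_trans.
have S i j : E i j = E j i by apply: state_sym.
have all4 : ~~ [&& E ord0 o1, E ord0 o2 & E ord0 o3].
  apply/negP=> /and3P[h1 h2 h3]; apply: (ends_not_connected vs) => i.
  by case: (ord4P i) => ->.
have h0 : E ord0 o1 || E ord0 o3.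
  have [j ej cj] := opposite_end s ord0; rewrite /E.
  case: (ord4P j) ej cj => -> ej; rewrite ?ej ?orbT // ?c1 ?c2 ?c3; by case: (c _).
have h1 : E o1 ord0 || E o1 o2.
  have [j ej cj] := opposite_end s o1; rewrite /E.
  case: (ord4P j) ej cj => -> ej; rewrite ?ej ?orbT // ?c1 ?c2 ?c3; by case: (c _).
have h2 : E o2 o1 || E o2 o3.
  have [j ej cj] := opposite_end s o2; rewrite /E.
  case: (ord4P j) ej cj => -> ej; rewrite ?ej ?orbT // ?c1 ?c2 ?c3; by case: (c _).
have h3 : E o3 ord0 || E o3 o2.
  have [j ej cj] := opposite_end s o3; rewrite /E.
  case: (ord4P j) ej cj => -> ej; rewrite ?ej ?orbT // ?c1 ?c2 ?c3; by case: (c _).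
change ((E o1 o2 && E o3 ord0) = ~~ (E ord0 o1 && E o2 o3)).
move: h0 h1 h2 h3 all4 (tr ord0 o1 o2) (tr ord0 o3 o2) (tr ord0 o2 o1) (tr ord0 o2 o3)
  (tr o1 ord0 o3) (tr o1 o2 o3).
rewrite (S o1 ord0) (S o2 o1) (S o3 ord0) (S o3 o2).
move: (E ord0 o1) (E ord0 o3) (E o1 o2) (E o2 o3) (E ord0 o2) (E o1 o3).
by do 6 case; move=> //= *; intuition.
Qed.

End Ends.

Lemma not_graded_bracket :
    tangle_coef v join01 <> 0 -> tangle_coef v join12 <> 0 ->
  ~ exists k, graded k (bracket K).
Proof.
have [c [cm cr]] := checkerboard_coloring (diagram_planar K).
have vs s : s \subset classical_crossings K -> v \notin s.
  by move/subsetP=> sC; apply/negP=> /sC; rewrite inE v_virtual.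
(* The parity required by [graded_state] is read off the closure of the state by a smoothing of v.
   For [join12] the curve through v and the element v of the state contribute one each and cancel;
   for [join01] only the curve does. *)
pose n := (3 * #|classical_crossings K| + 2 * odd (loops (@smooth K set0)))%N.
have bl1 (p q r : bool) : ~~ p = r (+) ~~ q -> q (+) p = r by case: p q r => [] [] [].
have bl2 (p q r : bool) : ~~ p = r (+) q -> q (+) p = ~~ r by case: p q r => [] [] [].
have graded12 : graded n (tangle_coef v join12).
  apply: graded_sum => s /andP[sC s12]; apply: (graded_state sC).
  have [E _] := loops12 (vs s sC) s12.
  have := odd_loops cm cr (v |: s); rewrite E cardsU1 (vs s sC) => E2; rewrite [LHS]oddD.
  apply: (@bl1 _ (odd #|s|)); exact: E2.
have graded01 : graded (n + 2) (tangle_coef v join01).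
  apply: (@graded_mod (3 * #|classical_crossings K| + 2 * ~~ odd (loops (@smooth K set0)))).
    by rewrite /n; case: (odd (loops _)) => /=; lia.
  apply: graded_sum => s /andP[sC s01]; apply: (graded_state sC).
  have [E _] := loops01 (vs s sC) s01.
  have := odd_loops cm cr s; rewrite E => E2; rewrite [LHS]oddD.
  apply: (@bl2 _ (odd #|s|)); exact: E2.
have bracketE : bracket K = loop_value * tangle_coef v join12 + loop_value * tangle_coef v join01.
  rewrite /bracket /state_sum (bigID (fun s => state_joins s v join12)) /=.
  rewrite /tangle_coef !big_distrr /=; congr (_ + _).
    apply: eq_bigr => s /andP[sC s12].
    have [_ ->] := loops12 (vs s sC) s12.
    by rewrite exprS mulrCA.
  apply: eq_big => s.
    case: (boolP (s \subset _)) => // sC.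
    by rewrite (state_joins_cases cm cr (vs s sC)) negbK.
  rewrite andbC => /andP[s01 sC]; rewrite (state_joins_cases cm cr (vs s sC)) negbK in s01.
  have [_ ->] := loops01 (vs s sC) s01.
  by rewrite exprS mulrCA.
move=> nz01 nz12 [k]; rewrite bracketE => gK.
have g12 := gradedM graded_loop_value graded12.
have g01 := gradedM graded_loop_value graded01; rewrite addnA in g01.
have [] := graded_indep g12 g01 gK => /eqP; rewrite mulf_eq0 (negPf loop_value_neq0) => /eqP //.
Qed.
End OneVirtual.

(** * Erasing crossings *)

(** In [erased] the number of passes is only known to exist; since [pass] stops on leaving S, any
    exit from S along a strand is the same dart. *)
Lemma iter_fixpoint_uniq (T : Type) (h : T -> T) (a : T) n m :
    h (iter n h a) = iter n h a -> h (iter m h a) = iter m h a ->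
  iter n h a = iter m h a.
Proof.
have fix_add k l : h (iter k h a) = iter k h a -> iter (l + k) h a = iter k h a.
  by move=> hk; elim: l => //= l ->.
move=> hn hm; case/orP: (leq_total n m) => /subnK le.
  by rewrite -[in RHS]le fix_add.
by rewrite -[in LHS]le fix_add.
Qed.

Section Compatible.
Variables (D D0 : prediagram) (f : dart D0 -> dart D).
Hypotheses (f_inj : injective f) (f_compat : compatible f).

Definition crossing_map (x : crossing D0) : crossing D := (f (x, ord0)).1.
Local Notation g := crossing_map.

Lemma crossing_mapE d : (f d).1 = g d.1.
Proof.
have [fr _ _] := f_compat.
have := @dart_rot4 _ (d.1, ord0) d erefl; rewrite !inE.
by case/or4P=> /eqP->; rewrite ?fr.
Qed.

Lemma crossing_map_inj : injective g.
Proof.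
move=> x y gxy; have [fr _ _] := f_compat.
have := @dart_rot4 _ (f (x, ord0)) (f (y, ord0)) (esym gxy); rewrite !inE -!fr !(inj_eq f_inj).
by case/or4P=> /eqP/(congr1 fst).
Qed.

Lemma compatible_full_smooth s d : f (full_smooth s d) = full_smooth (g @: s) (f d).
Proof.
have [fr fv fo] := f_compat; rewrite /full_smooth fv.
case: (boolP (virtual d.1)) => vd; first by rewrite /straight !fr.
rewrite !smooth_rot4 crossing_mapE (mem_imset _ _ crossing_map_inj) fo //.
by case: ifP; rewrite /straight ?fr.
Qed.

Lemma classical_imset :
  {in classical_crossings D0, forall x, g x \in classical_crossings D}.
Proof.
have [_ fv _] := f_compat.
by move=> x; rewrite !inE => vx; rewrite fv.
Qed.

End Compatible.

Section Erased.
Variables (D D0 : prediagram) (S : {set crossing D}) (f : dart D0 -> dart D).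
Hypothesis f_erased : erased S f.
Local Notation g := (crossing_map f).

Let f_inj : injective f. Proof. by case: f_erased. Qed.
Let f_compat : compatible f. Proof. by case: f_erased. Qed.
Let f_codom e : (e \in codom f) = (e.1 \notin S). Proof. by case: f_erased. Qed.

Lemma erased_notin d : (f d).1 \notin S.
Proof. by rewrite -f_codom codom_f. Qed.

Lemma classical_erased :
  classical_crossings D :\: S = g @: classical_crossings D0.
Proof.
have [_ fv _] := f_compat; apply/setP=> x; rewrite in_setD.
apply/andP/imsetP => [[xS] | [y yC ->]].
  have /codomP[d xd] : (x, ord0) \in codom f by rewrite f_codom.
  move/(congr1 fst): xd (fv d) => /= xd; rewrite !inE xd => vd xC.
  by exists d.1; rewrite ?(crossing_mapE f_compat) // inE -vd.
by rewrite (classical_imset f_compat yC); split=> //; apply: (erased_notin (y, ord0)).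
Qed.

Definition straight_on (j : dart D -> dart D) d := if d.1 \in S then straight d else j d.

Lemma straight_onK j : (forall d, (j d).1 = d.1) -> involutive j ->
  involutive (straight_on j).
Proof.
move=> j1 jK d; rewrite /straight_on; case: (boolP (d.1 \in S)) => dS /=.
  by rewrite dS straightK.
by rewrite j1 (negPf dS) jK.
Qed.

Lemma full_smooth1 (E : prediagram) (s : {set crossing E}) d : (full_smooth s d).1 = d.1.
Proof. by rewrite /full_smooth; case: ifP. Qed.

(** Forgetting the crossings of S amounts to going straight through them in every state. Curves
    lying entirely over S become the new circles; on the other darts [f] is an adjunction. *)
Lemma erased_loops s :
  loops (full_smooth s) = loops (straight_on (full_smooth (g @: s))).
Proof.
have [_ _ _ f_mate Ecirc] := f_erased.
pose j := straight_on (full_smooth (g @: s)); rewrite /loops Ecirc -addnA -/j.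
congr (_ + _)%N; rewrite (n_compC (closed_in S)).
have jK : involutive j by apply: straight_onK (full_smooth1 _) (@full_smoothK _ _).
have jS := step_sym jK.
have strS : connect_sym (@strand_rel D) := step_sym (@straightK D).
have in_S d : d \in closed_in S -> d.1 \in S.
  by rewrite inE => /forallP/(_ d); rewrite connect0.
have j_in d : d.1 \in S -> j d = straight d by rewrite /j /straight_on => ->.
have cl_str : closed (@strand_rel D) (closed_in S).
  apply: (intro_closed strS) => d e de; rewrite !inE => /forallP cd.
  by apply/forallP=> z; apply/implyP=> /(connect_trans (connect1 de)); apply/implyP.
have eq_step d e : d \in closed_in S -> strand_rel d e = step_rel j d e.
  by move/in_S => dS; rewrite /strand_rel /step_rel /= j_in.
have cl_j : closed (step_rel j) (closed_in S).
  apply: (intro_closed jS) => d e de dS; rewrite -(cl_str d e) // eq_step //.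
rewrite -(eq_n_comp_closed cl_str eq_step); congr (_ + _)%N.
pose a := [predC (closed_in S)].
have cl_a : closed (step_rel j) a by apply: predC_closed.
have s0S := step_sym (@full_smoothK D0 s).
have f_a d : f d \in a by rewrite inE; apply: contra (erased_notin d) => /in_S.
suff adj : rel_adjunction f (step_rel j) (step_rel (full_smooth s)) a.
  rewrite (adjunction_n_comp f jS s0S cl_a adj).
  by apply: eq_n_comp_r => d; rewrite [RHS]f_a.
have j_f d : j (f d) = f (full_smooth s d).
  by rewrite compatible_full_smooth // /j /straight_on (negPf (erased_notin d)).
have to_f d : d.1 \notin S -> {x | d = f x}.
  by move=> dS; have /codomP/sig_eqW := etrans (f_codom d) dS.
have pass_in e : e.1 \in S -> pass S e = mate (straight e) by rewrite /pass => ->.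
have pass_notin e : e.1 \notin S -> pass S e = e by rewrite /pass => /negPf->.
have pass_f d n : (iter n (pass S) (mate (f d))).1 \notin S ->
    iter n (pass S) (mate (f d)) = f (mate d).
  move=> nS; have [m Em] := f_mate d; rewrite Em.
  by apply: iter_fixpoint_uniq; rewrite -?Em pass_notin ?erased_notin.
have connect_pass e n : connect (step_rel j) e (iter n (pass S) e).
  elim: n => //= n /connect_trans; apply; rewrite {2}/pass.
  case: ifP => // eS; rewrite -j_in //.
  exact: connect_trans (connect1 (step_join _ _)) (connect1 (step_mate _ _)).
split=> [d|x y _].
  (* Inside S a curve follows its strand; as this strand leaves S, it reaches the image of [f] at
     its first crossing outside S. *)
  rewrite !inE negb_forall => /existsP ex; apply: sigW; case: ex => e.
  rewrite negb_imply => /andP[/connectP[p dp ->] {e}].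
  elim: p d dp => [|e p IHp] d /=.
    by move=> _ /to_f[x ->]; exists x; apply: connect0.
  case/andP=> de ep pS; case: (boolP (d.1 \in S)) => [dS | /to_f[x ->]].
    have [x ex] := IHp e ep pS; exists x; apply: connect_trans (connect1 _) ex.
    by move: de; rewrite /strand_rel /step_rel /= j_in.
  by exists x; apply: connect0.
apply/idP/idP => [/connectP[p xp ->]|].
  elim: p x xp => //= z p IHp x /andP[xz zp].
  apply: connect_trans (IHp z zp); case/orP: xz => /eqP->.
    have [n ->] := f_mate x.
    exact: connect_trans (connect1 (step_mate _ _)) (connect_pass _ _).
  by rewrite -j_f; apply: connect1 (step_join _ _).
(* [Z] collects the darts met between crossings of D0 on the strands issued from darts connected to
   x. It is closed under both steps, so a path of D starting at [f x] stays in it, and its darts in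
   the image of [f] come from darts connected to x. *)
pose on_strand x' z := z = f x' \/ exists n, let w := iter n (pass S) (mate (f x')) in
  z = w \/ w.1 \in S /\ z = straight w.
pose Z z := exists2 x', connect (step_rel (full_smooth s)) x x' & on_strand x' z.
have Zf z : Z (f z) -> connect (step_rel (full_smooth s)) x z.
  case=> x' xx' [/f_inj-> // | [n [zn|[wS zw]]]].
    have := pass_f x' n; rewrite -zn erased_notin => /(_ isT)/f_inj->.
    exact: connect_trans xx' (connect1 (step_mate _ _)).
  by have := erased_notin z; rewrite zw wS.
have Zmate z : Z z -> Z (mate z).
  case=> x' xx' [-> | [n [->|[wS ->]]]].
  - by exists x' => //; right; exists 0; left.
  - elim: n => [|n IHn] /=; first by exists x' => //; left; rewrite mateK.
    case: (boolP ((iter n (pass S) (mate (f x'))).1 \in S)) => wS; last by rewrite pass_notin.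
    rewrite pass_in // mateK.
    by exists x' => //; right; exists n; right.
  - by exists x' => //; right; exists n.+1; left; rewrite iterS pass_in.
have Zj z : Z z -> Z (j z).
  case=> x' xx' [-> | [n [->|[wS ->]]]].
  - rewrite j_f; exists (full_smooth s x'); last by left.
    exact: connect_trans xx' (connect1 (step_join _ _)).
  - case: (boolP ((iter n (pass S) (mate (f x'))).1 \in S)) => wS.
      by rewrite j_in //; exists x' => //; right; exists n; right.
    rewrite pass_f // j_f; exists (full_smooth s (mate x')); last by left.
    apply: connect_trans xx' _.
    exact: connect_trans (connect1 (step_mate _ _)) (connect1 (step_join _ _)).
  - by rewrite j_in //= straightK; exists x' => //; right; exists n; left.
have Zx : Z (f x) by exists x; [apply: connect0 | left].
case/connectP=> p xp Ey; apply: Zf; rewrite Ey.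
elim: p (f x) Zx xp {Ey} => //= z p IHp z' Zz' /andP[zz' zp].
by apply: IHp zp; case/orP: zz' => /eqP->; [apply: Zmate | apply: Zj].
Qed.
End Erased.

(** * State sums *)

Lemma eq_state_sum (X : finType) (C : {set X}) L L' :
  (forall s : {set X}, s \subset C -> L s = L' s) -> state_sum C L = state_sum C L'.
Proof. by move=> LL'; apply: eq_bigr => s /LL'->. Qed.

Lemma state_sumS (X : finType) (C : {set X}) L :
  state_sum C (fun s => (L s).+1) = loop_value * state_sum C L.
Proof. by rewrite /state_sum big_distrr /=; apply: eq_bigr => s _; rewrite exprS mulrCA. Qed.

Lemma state_sum_imset (X Y : finType) (g : X -> Y) (C : {set X}) L :
  injective g -> state_sum (g @: C) L = state_sum C (fun s => L (g @: s)).
Proof.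
move=> g_inj; rewrite /state_sum.
have gK (s : {set X}) : g @^-1: (g @: s) = s.
  by apply/setP=> x; rewrite inE mem_imset.
have gS (s : {set X}) : (g @: s \subset g @: C) = (s \subset C).
  by apply/idP/idP=> [/(preimsetS g)|]; [rewrite !gK | apply: imsetS].
rewrite (reindex_onto (fun s : {set X} => g @: s) (fun t => g @^-1: t)) /=.
  apply: eq_big => s; first by rewrite gK eqxx andbT gS.
  move=> /andP[gsC _]; have sC : s \subset C by rewrite -gS.
  by rewrite /state_weight (cardsDS gsC) (cardsDS sC) !(card_imset _ g_inj).
move=> t tC; apply/setP=> y; apply/imsetP/idP=> [[x + ->]|yt]; first by rewrite inE.
have /imsetP[x xC yx] := subsetP tC y yt.
by exists x; rewrite // inE -yx.
Qed.

(** This is the defining relation of the bracket at the crossing x. *)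
Lemma state_sum_split (X : finType) (C : {set X}) x L : x \in C ->
  state_sum C L = varA * state_sum (C :\ x) (fun s => L (x |: s))
                + varA^-1 * state_sum (C :\ x) L.
Proof.
move=> xC; rewrite /state_sum (bigID (fun s : {set X} => x \in s)) /=.
rewrite !big_distrr /=; congr (_ + _).
  rewrite (reindex_onto (fun s : {set X} => x |: s) (fun t => t :\ x)) /=; last first.
    by move=> t /andP[_ xt]; rewrite setD1K.
  apply: eq_big => s.
    rewrite setU11 andbT subUset sub1set xC /= subsetD1.
    by congr (_ && _); apply/eqP/idP=> [<-|xs]; [rewrite setD11 | rewrite setU1K].
  rewrite setU11 andbT => /andP[sC /eqP sx].
  have xs : x \notin s by rewrite -sx setD11.
  rewrite /state_weight (_ : C :\: (x |: s) = (C :\ x) :\: s) ?setDDl //.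
  by rewrite cardsU1 xs exprS !mulrA.
apply: eq_big => s; first by rewrite subsetD1.
case/andP=> sC xs; rewrite /state_weight (cardsD1 x (C :\: s)) in_setD xs xC.
have -> : (C :\: s) :\ x = (C :\ x) :\: s by rewrite !setDDl setUC.
rewrite add1n exprS invfM; ring.
Qed.

Lemma eq_loops (D : prediagram) (j j' : dart D -> dart D) :
  j =1 j' -> loops j = loops j'.
Proof.
move=> jj'; have E : step_rel j =2 step_rel j'.
  by move=> d e; rewrite /step_rel /= jj'.
by rewrite /loops (eq_n_comp (eq_connect E)).
Qed.

Section ErasedBracket.
Variables (D D0 : prediagram) (S : {set crossing D}) (f : dart D0 -> dart D).
Hypothesis f_erased : erased S f.

Lemma bracket_erased :
  bracket D0 = state_sum (classical_crossings D :\: S)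
                 (fun s => loops (straight_on S (full_smooth s))).
Proof.
have [f_inj f_compat _ _ _] := f_erased.
rewrite (classical_erased f_erased) state_sum_imset; last exact: crossing_map_inj.
by apply: eq_state_sum => s _; apply: erased_loops.
Qed.

(** States already go straight through virtual crossings, which settles isomorphisms and both kinds
    of detours. *)
Lemma bracket_erased_virtual :
  {in S, forall x, virtual x} -> bracket D0 = bracket D.
Proof.
move=> S_virtual; rewrite bracket_erased.
have -> : classical_crossings D :\: S = classical_crossings D.
  apply/setDidPl; rewrite disjoints_subset; apply/subsetP=> x; rewrite !inE.
  by apply: contra => /S_virtual.
apply: eq_state_sum => s _; apply: eq_loops => d; rewrite /straight_on.
by case: ifP => // /S_virtual vd; rewrite /full_smooth vd.
Qed.
End ErasedBracket.

(** * Counting the invariant two-colourings of the darts *)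

Local Open Scope nat_scope.

(* Numbers of components are compared by counting invariant functions: local
   changes of a relation become Boolean identities. *)
Lemma card_invariants (T : finType) (e : rel T) : connect_sym e ->
  #|[pred c : {ffun T -> bool} | [forall x, forall y, e x y ==> (c x == c y)]]|
    = 2 ^ n_comp e T.
Proof.
move=> e_sym; pose R := [set x | roots e x].
have -> : n_comp e T = #|R|.
  by rewrite n_comp_roots cardsE; apply: eq_card => x; rewrite !inE andbT.
pose F (A : {set T}) : {ffun T -> bool} := [ffun x => fingraph.root e x \in A].
have F_inj : {in powerset R &, injective F}.
  move=> A B; rewrite !inE => /subsetP AR /subsetP BR /ffunP FAB.
  have rR x : x \in R -> fingraph.root e x = x by rewrite inE => /eqP.
  apply/setP=> x; have := FAB x; rewrite !ffunE.
  case: (boolP (x \in R)) => [/rR->//|xR] _.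
  by rewrite (negbTE (contra (AR x) xR)) (negbTE (contra (BR x) xR)).
rewrite -card_powerset -(card_in_imset F_inj); apply: eq_card => c.
apply/idP/imsetP => [/forallP c_inv|[A _ ->]]; last first.
  apply/forallP=> x; apply/forallP=> y; apply/implyP=> xy; rewrite !ffunE.
  by rewrite (fingraph.rootP e_sym (connect1 xy)).
exists [set x in R | c x]; first by rewrite inE; apply/subsetP=> x; rewrite inE => /andP[].
apply/ffunP=> x; rewrite ffunE !inE roots_root //=.
have /connectP[p] := connect_root e x; move: (fingraph.root e x) => y.
elim: p x => [|z p IHp] x /=; first by move=> _ ->.
case/andP=> xz zp /(IHp _ zp) <-.
by apply/eqP; have /forallP/(_ z)/implyP := c_inv x; apply.
Qed.

Section Flip.
Variable T : finType.
Implicit Types (u : pred T) (c : {ffun T -> bool}) (X : pred {ffun T -> bool}).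

Definition flip u c : {ffun T -> bool} := [ffun x => u x (+) c x].

Lemma flipK u : involutive (flip u).
Proof. by move=> c; apply/ffunP=> x; rewrite !ffunE addKb. Qed.

(** Flipping the values on u is a symmetry of X which exchanges the equation [c a = c o] with its
    negation: a value left free on an inner edge accounts for a factor 2. *)
Lemma card_flip u X a o : (forall c, X (flip u c) = X c) -> u a != u o ->
  #|X| = (2 * #|[pred c | X c && (c a == c o)]|)%N.
Proof.
move=> Xu ao; rewrite mul2n -addnn -(cardID [pred c : {ffun T -> bool} | c a == c o] X).
congr (_ + _)%N.
rewrite -[in LHS]cardsE -[in RHS]cardsE.
rewrite -(on_card_preimset (onW_bij _ (inv_bij (flipK u)))); apply: eq_card => c.
rewrite !inE !ffunE [_ \in X]unfold_in Xu andbC; congr (_ && _).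
by move: ao; case: (u a); case: (u o); case: (c a); case: (c o).
Qed.

End Flip.

Section Local.
Variable D : prediagram.
Implicit Types (d e : dart D) (j : dart D -> dart D) (S : {set crossing D}).
Implicit Types (c : {ffun dart D -> bool}) (h : dart D -> bool).

Local Notation F := {ffun dart D -> bool}.
Local Notation rot2 d := (rot4 (rot4 d)).
Local Notation rot3 d := (rot4 (rot4 (rot4 d))).

Lemma card_step j : involutive j ->
  #|[pred c : F | [forall d, c (mate d) == c d] && [forall d, c (j d) == c d]]|
    = 2 ^ n_comp (step_rel j) {: dart D}.
Proof.
move=> jK; rewrite -(card_invariants (step_sym jK)); apply: eq_card => c.
apply/andP/forallP => [[/forallP cm /forallP cj] d|cdj].
  by apply/forallP=> e; apply/implyP=> /orP[]/eqP->; rewrite eq_sym.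
split; apply/forallP=> d; rewrite eq_sym; have /forallP := cdj d.
  by move/(_ (mate d))/implyP; apply; apply: step_mate.
by move/(_ (j d))/implyP; apply; apply: step_join.
Qed.

(** The equations which a change of the state or of the passages inside S does not affect; those at
    S are given by [invariant_at]. *)
Definition invariant_off j S c :=
  [forall d, c (mate d) == c d] && [forall d, (d.1 \notin S) ==> (c (j d) == c d)].

Lemma invariant_off_mate j S c d : invariant_off j S c -> c (mate d) = c d.
Proof. by case/andP=> /forallP/(_ d)/eqP. Qed.

Lemma invariant_off_flip j S p c : (forall d, (j d).1 = d.1) ->
    p.1 \in S -> (mate p).1 \in S ->
  invariant_off j S (flip (pred2 p (mate p)) c) = invariant_off j S c.
Proof.
move=> j1 pS mS; congr (_ && _); apply: eq_forallb => d; rewrite !ffunE /=.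
  rewrite (inj_eq (@mate_inj D)) (can2_eq (@mateK D) (@mateK D)) orbC.
  by rewrite (inj_eq (@addbI _)).
case: (boolP (d.1 \in S)) => //= dS.
have nd e : e.1 = d.1 -> ((e == p) || (e == mate p)) = false.
  by move=> ed; apply/negP=> /orP[]/eqP ep; move: dS; rewrite -ed ep (pS, mS).
by rewrite !nd.
Qed.

Definition invariant_at j h d :=
  [&& h (j d) == h d, h (j (rot4 d)) == h (rot4 d),
      h (j (rot2 d)) == h (rot2 d) & h (j (rot3 d)) == h (rot3 d)].

Lemma forall_crossings S (ds : seq (dart D)) (P : pred (dart D)) :
    (forall x, (x \in S) = (x \in [seq d.1 | d <- ds])) ->
  [forall e, (e.1 \in S) ==> P e] =
    all (fun d => [&& P d, P (rot4 d), P (rot2 d) & P (rot3 d)]) ds.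
Proof.
move=> Sds; apply/forallP/allP=> [PS d dds|Pds e].
  have dS e : e.1 = d.1 -> P e.
    by move=> ed; apply: (implyP (PS e)); rewrite Sds ed map_f.
  by rewrite !dS.
apply/implyP; rewrite Sds => /mapP[d dds ed].
have := dart_rot4 ed; rewrite !inE.
by case/and4P: (Pds d dds) => ? ? ? ? /or4P[]/eqP->.
Qed.

Lemma card_invariant_at j j' S (ds : seq (dart D)) : involutive j' ->
    (forall d, d.1 \notin S -> j' d = j d) ->
    (forall x, (x \in S) = (x \in [seq d.1 | d <- ds])) ->
  #|[pred c : F | invariant_off j S c && all (invariant_at j' c) ds]|
    = 2 ^ n_comp (step_rel j') {: dart D}.
Proof.
move=> j'K j'S Sds; rewrite -card_step //; apply: eq_card => c; rewrite !inE /invariant_off.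
rewrite -andbA; congr (_ && _); rewrite -(forall_crossings (fun d => c (j' d) == c d) Sds).
apply/andP/forallP => [[/forallP cS /forallP cS'] d|cj].
  have := cS d; have := cS' d; case: (boolP (d.1 \in S)) => //= dS.
  by rewrite j'S.
by split; apply/forallP=> d; apply/implyP=> dS; rewrite -?j'S.
Qed.

Lemma invariant_at_full_smooth s h d : ~~ virtual d.1 ->
  invariant_at (full_smooth s) h d =
    if (d.1 \in s) == over d then (h d == h (rot3 d)) && (h (rot4 d) == h (rot2 d))
    else (h d == h (rot4 d)) && (h (rot2 d) == h (rot3 d)).
Proof.
move=> vd; rewrite /invariant_at /full_smooth /= (negPf vd) !smooth_rot4 !over_rot4 /straight !negbK.
case: (d.1 \in s); case: (over d) => /=; rewrite ?rot4_4;
  do 4 case: (h _) => //.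
Qed.

Lemma invariant_at_straight_on S j h d : d.1 \in S ->
  invariant_at (straight_on S j) h d = (h d == h (rot2 d)) && (h (rot4 d) == h (rot3 d)).
Proof.
move=> dS; rewrite /invariant_at /straight_on /= dS /straight !rot4_4.
by do 4 case: (h _).
Qed.

End Local.

(** * The bigon and the kink *)

Lemma expn2_44 m n : (4 * 2 ^ m = 4 * 2 ^ n)%N -> m = n.
Proof. by move/eqP; rewrite eqn_pmul2l // => /eqP/expnI->. Qed.

Lemma expn2_24 m n : (2 * 2 ^ m = 4 * 2 ^ n)%N -> m = (n + 1)%N.
Proof.
have -> : (4 * 2 ^ n = 2 ^ n.+2)%N by rewrite !expnS mulnA.
by rewrite -expnS addn1 => /(@expnI 2 isT)[].
Qed.

Section LocalMoves.
Variable D : prediagram.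
Implicit Types (d e : dart D) (s : {set crossing D}).
Local Notation F := {ffun dart D -> bool}.
Local Notation rot2 d := (rot4 (rot4 d)).
Local Notation rot3 d := (rot4 (rot4 (rot4 d))).

Lemma face_eq d e : face d = e -> mate d = rot3 e.
Proof. by move=> <-; rewrite /face rot4_4. Qed.

Lemma rot4_eqF d :
  ((rot4 d == d) = false) * ((d == rot4 d) = false) * ((rot2 d == d) = false) *
  ((d == rot2 d) = false) * ((rot3 d == d) = false) * ((d == rot3 d) = false).
Proof.
have := rot4_uniq d; rewrite /= !inE !negb_or -!andbA => /and3P[h1 h2 /andP[h3 _]].
rewrite (negPf h1) (negPf h2) (negPf h3); move: h1 h2 h3; rewrite ![d == _]eq_sym.
by move=> /negPf-> /negPf-> /negPf->.
Qed.

Local Notation rot_neqE := (inj_eq (@rot4_inj D), rot4_eqF).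

(** The edge at d returns to its own crossing at the neighbouring dart. One smoothing joins its two
    ends and splits off a circle, the other one leaves the strand connected, as the straight passage
    does. *)
Lemma R1_loops d s : ~~ virtual d.1 -> face d = d ->
  loops (full_smooth s) =
    (loops (straight_on [set d.1] (full_smooth s)) + ((d.1 \in s) == over d))%N.
Proof.
move=> vd /face_eq md; pose j := full_smooth s; pose S := [set d.1].
(* In [X] the value on the kink is free: a split circle keeps it free, and otherwise one equation
   with an outer value halves the count. *)
pose X : pred F := fun c => invariant_off j S c && (c (rot4 d) == c (rot2 d)).
have dS : d.1 \in S by apply: set11.
have cX : #|X| = (2 * #|[pred c | X c && (c d == c (rot4 d))]|)%N.
  apply: (card_flip (u := pred2 d (mate d))) => [c|].
    rewrite /X invariant_off_flip ?md //; last exact: full_smooth1.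
    by rewrite !ffunE /= !rot_neqE.
  by rewrite /= eqxx md !rot_neqE.
have Sd x : (x \in S) = (x \in [seq y.1 | y <- [:: d]]) by rewrite !inE.
have cj := card_invariant_at (@full_smoothK D s) (fun d _ => erefl (j d)) Sd.
have st1 e : e.1 \notin S -> straight_on S j e = j e by rewrite /straight_on => /negPf->.
have cs := card_invariant_at (straight_onK S (@full_smooth1 D s) (@full_smoothK D s)) st1 Sd.
have cmd c : invariant_off j S c -> c (rot3 d) = c d.
  by move=> inv; rewrite -md (invariant_off_mate d inv).
have {}cs : #|X| = (2 * 2 ^ n_comp (step_rel (straight_on S j)) {: dart D})%N.
  rewrite -cs cX; congr (2 * _)%N; apply: eq_card => c; rewrite !inE /= andbT /X.
  rewrite invariant_at_straight_on //; case inv: (invariant_off j S c) => //=.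
  by rewrite (cmd c inv); do 3 case: (c _).
rewrite /loops -addnA; congr (_ + _)%N; apply: (@expnI 2) => //.
rewrite -cj; case t: (_ == _); rewrite /= ?addn0 ?addn1 ?expnS -/S -/j.
  rewrite -cs; apply: eq_card => c; rewrite !inE /= andbT invariant_at_full_smooth // t.
  rewrite [c \in X]unfold_in /X; case inv: (invariant_off j S c) => //=.
  by rewrite (cmd c inv); do 3 case: (c _).
apply: double_inj; rewrite -!mul2n -cs cX; congr (2 * _)%N; apply: eq_card => c.
rewrite !inE /= andbT invariant_at_full_smooth // t /X; case inv: (invariant_off j S c) => //=.
by rewrite (cmd c inv); do 3 case: (c _).
Qed.

(** The conditions are triangular: the second flip respects the first equation, so that the count
    can be halved again. *)
Lemma card_flip2 (X : pred F) (u1 u2 : pred (dart D)) a1 o1 a2 o2 :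
    (forall c, X (flip u1 c) = X c) -> (forall c, X (flip u2 c) = X c) ->
    u1 a1 != u1 o1 -> u2 a1 = u2 o1 -> u2 a2 != u2 o2 ->
  #|X| = (4 * #|[pred c | X c && ((c a1 == c o1) && (c a2 == c o2))]|)%N.
Proof.
move=> X1 X2 u1a1 u2a1 u2a2; rewrite (card_flip X1 u1a1).
rewrite (@card_flip _ u2 [pred c : F | X c && (c a1 == c o1)] _ _ _ u2a2).
  by rewrite mulnA; congr (4 * _)%N; apply: eq_card => c; rewrite !inE /= andbA.
by move=> c; rewrite /= X2 !ffunE u2a1 (inj_eq (@addbI _)).
Qed.

Lemma card_flip3 (X : pred F) (u1 u2 u3 : pred (dart D)) a1 o1 a2 o2 a3 o3 :
    (forall c, X (flip u1 c) = X c) -> (forall c, X (flip u2 c) = X c) ->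
    (forall c, X (flip u3 c) = X c) ->
    u1 a1 != u1 o1 -> u2 a1 = u2 o1 -> u2 a2 != u2 o2 ->
    u3 a1 = u3 o1 -> u3 a2 = u3 o2 -> u3 a3 != u3 o3 ->
  #|X| = (8 * #|[pred c | X c && [&& c a1 == c o1, c a2 == c o2 & c a3 == c o3]]|)%N.
Proof.
move=> X1 X2 X3 u11 u21 u22 u31 u32 u33; rewrite (card_flip2 X1 X2 u11 u21 u22).
rewrite (@card_flip _ u3 [pred c : F | X c && ((c a1 == c o1) && (c a2 == c o2))] _ _ _ u33).
  by rewrite mulnA; congr (8 * _)%N; apply: eq_card => c; rewrite !inE /= -!andbA.
by move=> c; rewrite /= X3 !ffunE u31 u32 !(inj_eq (@addbI _)).
Qed.

Lemma neqF (d e : dart D) : d.1 != e.1 -> (d == e) = false.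
Proof. by move=> de; apply: contraNF de => /eqP->. Qed.

Section Bigon.
Variables (d e : dart D) (s0 : {set crossing D}).
Hypotheses (mate_d : mate d = rot3 e) (mate_e : mate e = rot3 d).
Hypotheses (de : d.1 != e.1) (vd : ~~ virtual d.1) (ve : ~~ virtual e.1).

Let S := [set d.1; e.1].
Let j := full_smooth s0.
Let ed : e.1 != d.1. Proof. by rewrite eq_sym. Qed.
Let dS : d.1 \in S. Proof. by rewrite !inE eqxx. Qed.
Let eS : e.1 \in S. Proof. by rewrite !inE eqxx orbT. Qed.

(** A state joins the four outer ends either at each corner, [Xpar], or across the bigon, [Xthr].
    The values on the two inner edges remain free. *)
Let Xpar : pred F := fun c => invariant_off j S c &&
  ((c (rot4 d) == c (rot2 d)) && (c (rot4 e) == c (rot2 e))).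
Let Xthr : pred F := fun c => invariant_off j S c &&
  ((c (rot4 d) == c (rot2 e)) && (c (rot2 d) == c (rot4 e))).

Let ud := pred2 d (mate d).
Let ue := pred2 e (mate e).

Let ud_d : ud d = true. Proof. by rewrite /ud /= eqxx. Qed.
Let ue_e : ue e = true. Proof. by rewrite /ue /= eqxx. Qed.
Let ud_e : ud e = false.
Proof. by rewrite /ud /= mate_d !rot_neqE neqF. Qed.
Let ue_d : ue d = false.
Proof. by rewrite /ue /= mate_e !rot_neqE neqF. Qed.
Let ud_out : (ud (rot4 d) = false) * (ud (rot2 d) = false) *
  (ud (rot4 e) = false) * (ud (rot2 e) = false).
Proof. by rewrite /ud /= mate_d !rot_neqE !neqF. Qed.
Let ue_out : (ue (rot4 d) = false) * (ue (rot2 d) = false) *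
  (ue (rot4 e) = false) * (ue (rot2 e) = false).
Proof. by rewrite /ue /= mate_e !rot_neqE !neqF. Qed.

Let X_flip u : u = ud \/ u = ue -> forall c,
  Xpar (flip u c) = Xpar c /\ Xthr (flip u c) = Xthr c.
Proof.
case=> -> c; rewrite /Xpar /Xthr invariant_off_flip ?mate_d ?mate_e //;
  try exact: full_smooth1; by rewrite !ffunE ?ud_out ?ue_out.
Qed.
Let Xpar_d c : Xpar (flip ud c) = Xpar c. Proof. by apply: (X_flip _ c).1; left. Qed.
Let Xpar_e c : Xpar (flip ue c) = Xpar c. Proof. by apply: (X_flip _ c).1; right. Qed.
Let Xthr_d c : Xthr (flip ud c) = Xthr c. Proof. by apply: (X_flip _ c).2; left. Qed.
Let Xthr_e c : Xthr (flip ue c) = Xthr c. Proof. by apply: (X_flip _ c).2; right. Qed.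

Let Sds x : (x \in S) = (x \in [seq y.1 | y <- [:: d; e]]).
Proof. by rewrite !inE. Qed.

Let inv_mate c : invariant_off j S c -> c (rot3 e) = c d /\ c (rot3 d) = c e.
Proof.
by move=> inv; rewrite -mate_d -mate_e !(invariant_off_mate _ inv).
Qed.

Lemma bigon_straight :
  #|Xthr| = (4 * 2 ^ n_comp (step_rel (straight_on S j)) {: dart D})%N.
Proof.
have st1 x : x.1 \notin S -> straight_on S j x = j x by rewrite /straight_on => /negPf->.
rewrite -(card_invariant_at (straight_onK S (@full_smooth1 D s0) (@full_smoothK D s0)) st1 Sds).
rewrite (@card_flip2 _ ud ue d (rot2 d) e (rot4 d)) ?ud_d ?ue_e ?ue_d ?ud_out ?ue_out //.
congr (4 * _)%N; apply: eq_card => c; rewrite !inE /= andbT /Xthr.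
rewrite !invariant_at_straight_on //; case inv: (invariant_off j S c) => //=.
have [-> ->] := inv_mate inv.
by do 6 case: (c _).
Qed.

(** The test at a corner is true if the smoothing joins the two inner ends there. When both are true
    the inner edges form a loop, so that only one equation bears on them: hence the factor 2 in
    place of 4. *)
Lemma bigon_smooth s : (forall x, x \notin S -> (x \in s) = (x \in s0)) ->
  let n := n_comp (step_rel (full_smooth s)) {: dart D} in
  match (d.1 \in s) == over d, (e.1 \in s) == over e with
  | true, true => #|Xpar| = (2 * 2 ^ n)%N
  | false, false => #|Xthr| = (4 * 2 ^ n)%N
  | _, _ => #|Xpar| = (4 * 2 ^ n)%N
  end.
Proof.
move=> ss0 n.
have js x : x.1 \notin S -> full_smooth s x = j x.
  by move=> xS; rewrite /j /full_smooth /smooth ss0.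
rewrite /n -(card_invariant_at (@full_smoothK D s) js Sds).
case td: (_ == _); case te: (_ == _).
- rewrite (@card_flip _ ud _ d e) ?ud_d ?ud_e //.
  congr (2 * _)%N; apply: eq_card => c; rewrite !inE /= andbT /Xpar.
  rewrite !invariant_at_full_smooth // td te; case inv: (invariant_off j S c) => //=.
  by have [-> ->] := inv_mate inv; do 6 case: (c _).
- rewrite (@card_flip2 _ ud ue d (rot4 e) e (rot4 e)) ?ud_d ?ue_e ?ue_d ?ud_out ?ue_out //.
  congr (4 * _)%N; apply: eq_card => c; rewrite !inE /= andbT /Xpar.
  rewrite !invariant_at_full_smooth // td te; case inv: (invariant_off j S c) => //=.
  by have [-> ->] := inv_mate inv; do 6 case: (c _).
- rewrite (@card_flip2 _ ud ue d (rot4 d) e (rot4 d)) ?ud_d ?ue_e ?ue_d ?ud_out ?ue_out //.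
  congr (4 * _)%N; apply: eq_card => c; rewrite !inE /= andbT /Xpar.
  rewrite !invariant_at_full_smooth // td te; case inv: (invariant_off j S c) => //=.
  by have [-> ->] := inv_mate inv; do 6 case: (c _).
- rewrite (@card_flip2 _ ud ue d (rot4 d) e (rot4 e)) ?ud_d ?ue_e ?ue_d ?ud_out ?ue_out //.
  congr (4 * _)%N; apply: eq_card => c; rewrite !inE /= andbT /Xthr.
  rewrite !invariant_at_full_smooth // td te; case inv: (invariant_off j S c) => //=.
  by have [-> ->] := inv_mate inv; do 6 case: (c _).
Qed.

Let n_loops (j1 j2 : dart D -> dart D) k :
  n_comp (step_rel j1) {: dart D} = (n_comp (step_rel j2) {: dart D} + k)%N ->
  loops j1 = (loops j2 + k)%N.
Proof. by move=> E; rewrite /loops E addnA. Qed.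

Lemma bigon_loops_through :
    ((d.1 \in s0) == over d) = false -> ((e.1 \in s0) == over e) = false ->
  loops (full_smooth s0) = loops (straight_on [set d.1; e.1] (full_smooth s0)).
Proof.
move=> td te; rewrite -[RHS]addn0; apply: n_loops; rewrite addn0.
have := bigon_smooth (fun x _ => erefl (x \in s0)); rewrite /= td te => H.
exact: expn2_44 (etrans (esym H) bigon_straight).
Qed.

Lemma bigon_loops_parallel s :
    (forall x, x \notin [set d.1; e.1] -> (x \in s) = (x \in s0)) ->
    ((d.1 \in s0) == over d) != ((e.1 \in s0) == over e) ->
    ((d.1 \in s) == over d) || ((e.1 \in s) == over e) ->
  loops (full_smooth s) =
    (loops (full_smooth s0) + ((d.1 \in s) == over d) && ((e.1 \in s) == over e))%N.
Proof.
move=> ss0 t0 t; apply: n_loops.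
have := bigon_smooth (fun x _ => erefl (x \in s0)); have := bigon_smooth ss0.
move: t0 t => /=.
case: ((d.1 \in s) == over d); case: ((e.1 \in s) == over e);
  case: ((d.1 \in s0) == over d); case: ((e.1 \in s0) == over e) => //= _ _ H1 H2.
- exact: expn2_24 (etrans (esym H1) H2).
- exact: expn2_24 (etrans (esym H1) H2).
- rewrite addn0; exact: expn2_44 (etrans (esym H1) H2).
- rewrite addn0; exact: expn2_44 (etrans (esym H1) H2).
- rewrite addn0; exact: expn2_44 (etrans (esym H1) H2).
- rewrite addn0; exact: expn2_44 (etrans (esym H1) H2).
Qed.
End Bigon.
End LocalMoves.

(** * First and second moves *)

Local Open Scope ring_scope.

Lemma loop_valueE : loop_value = - (varA * varA) - varA^-1 * varA^-1.
Proof. by rewrite /loop_value -exprVn !expr2. Qed.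

Lemma full_smooth_off_set (D : prediagram) (s s' : {set crossing D}) (d : dart D) :
  (d.1 \in s) = (d.1 \in s') -> full_smooth s d = full_smooth s' d.
Proof. by move=> ss'; rewrite /full_smooth /smooth ss'. Qed.

Lemma kink_over (F : fieldType) (a z : F) : a != 0 ->
  a * ((- (a * a) - a^-1 * a^-1) * z) + a^-1 * (1 * z) = - a ^+ 3 * z.
Proof. by move=> a0; field. Qed.

Lemma kink_under (F : fieldType) (a z : F) : a != 0 ->
  a * (1 * z) + a^-1 * ((- (a * a) - a^-1 * a^-1) * z) = - a ^- 3 * z.
Proof. by move=> a0; field. Qed.

(* The smoothings which turn the bigon back cancel against the one in which the
   bigon is a loop. *)
Lemma bigon_cancel (F : fieldType) (a z w : F) : a != 0 ->
  a * (a * z + a^-1 * ((- (a * a) - a^-1 * a^-1) * z)) + a^-1 * (a * w + a^-1 * z) = w.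
Proof. by move=> a0; field. Qed.

Lemma Reidemeister1_bracket (D D' : diagram) : Reidemeister1 D D' ->
  bracket D = - varA ^+ 3 * bracket D' \/ bracket D = - varA ^- 3 * bracket D'.
Proof.
case=> d [f [vd fd er]].
pose C := classical_crossings D; pose x := d.1.
pose L (s : {set crossing D}) := loops (straight_on [set x] (full_smooth s)).
have -> : bracket D' = state_sum (C :\ x) L := bracket_erased er.
have xC : x \in C by rewrite inE.
rewrite /bracket -/C (state_sum_split _ xC).
have E1 : state_sum (C :\ x) (fun s => loops (full_smooth (x |: s)))
   = (if over d then loop_value else 1) * state_sum (C :\ x) L.
  transitivity (state_sum (C :\ x) (fun s => (L s + over d)%N)).
    apply: eq_state_sum => s _.
    have EL : loops (straight_on [set x] (full_smooth (x |: s))) = L s.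
      apply: eq_loops => e; rewrite /straight_on in_set1; case: (boolP (e.1 == x)) => // ex.
      by apply: full_smooth_off_set; rewrite in_setU1 (negPf ex).
    by rewrite (R1_loops _ vd fd) EL setU11.
  case: (over d).
    by rewrite -state_sumS; apply: eq_state_sum => s _; rewrite addn1.
  by rewrite mul1r; apply: eq_state_sum => s _; rewrite addn0.
have E2 : state_sum (C :\ x) (fun s => loops (full_smooth s))
   = (if over d then 1 else loop_value) * state_sum (C :\ x) L.
  transitivity (state_sum (C :\ x) (fun s => (L s + ~~ over d)%N)).
    apply: eq_state_sum => s; rewrite subsetD1 => /andP[_ /negPf xs].
    by rewrite (R1_loops _ vd fd) -/x xs /L; case: (over d).
  case: (over d).
    by rewrite mul1r; apply: eq_state_sum => s _; rewrite addn0.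
  by rewrite -state_sumS; apply: eq_state_sum => s _; rewrite addn1.
move: (congr2 (fun a b => varA * a + varA^-1 * b) E1 E2) => {E1 E2} /= ->.
have A0 := varA_neq0; move: (state_sum _ L) => Z; rewrite loop_valueE.
by case: (over d); [left; apply: kink_over | right; apply: kink_under].
Qed.

Lemma state_sum_split2 (X : finType) (C : {set X}) x y L :
    x \in C -> y \in C :\ x ->
  state_sum C L =
    varA * (varA * state_sum (C :\ x :\ y) (fun s => L (x |: (y |: s)))
            + varA^-1 * state_sum (C :\ x :\ y) (fun s => L (x |: s)))
    + varA^-1 * (varA * state_sum (C :\ x :\ y) (fun s => L (y |: s))
            + varA^-1 * state_sum (C :\ x :\ y) L).
Proof.
move=> xC yC; rewrite (state_sum_split L xC) (state_sum_split L yC).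
by rewrite (state_sum_split (fun s => L (x |: s)) yC).
Qed.

(** Stated for any loop count, this serves for the second move and for both sides of the third one,
    once a corner of the triangle has been smoothed. *)
Lemma state_sum_bigon (X : finType) (C : {set X}) x y L :
    x \in C -> y \in C :\ x ->
    (forall s : {set X}, s \subset C :\ x :\ y ->
       L (x |: s) = (L (x |: (y |: s))).+1 /\ L s = L (x |: (y |: s))) ->
  state_sum C L = state_sum (C :\ x :\ y) (fun s => L (y |: s)).
Proof.
move=> xC yC HL; rewrite (state_sum_split2 L xC yC).
have E1 : state_sum (C :\ x :\ y) (fun s => L (x |: s))
    = loop_value * state_sum (C :\ x :\ y) (fun s => L (x |: (y |: s))).
  by rewrite -state_sumS; apply: eq_state_sum => s /HL[].
have E2 : state_sum (C :\ x :\ y) L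
    = state_sum (C :\ x :\ y) (fun s => L (x |: (y |: s))).
  by apply: eq_state_sum => s /HL[].
by rewrite E1 E2 loop_valueE; apply: bigon_cancel varA_neq0.
Qed.

Lemma Reidemeister2_bracket (D D' : diagram) : Reidemeister2 D D' ->
  bracket D = bracket D'.
Proof.
case=> d [f [[ffd de] [vd ve] /andP[od om] er]].
set e := face d in ffd de ve er *.
have oe : over e = false by rewrite /e /face over_rot4 om.
have md : mate d = rot4 (rot4 (rot4 e)) := face_eq (erefl e).
have me : mate e = rot4 (rot4 (rot4 d)) := face_eq ffd.
pose C := classical_crossings D; pose x := d.1; pose y := e.1; pose S := [set x; y].
pose L (s : {set crossing D}) := loops (straight_on S (full_smooth s)).
have -> : bracket D' = state_sum (C :\ x :\ y) L.
  by rewrite setDDl; apply: bracket_erased er.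
have xy : x != y by rewrite eq_sym.
have xC : x \in C by rewrite inE.
have yC : y \in C :\ x by rewrite !inE de.
pose par (s : {set crossing D}) := loops (full_smooth (x |: (y |: s))).
(* Since [over d] is true and [over e] false, a corner is turned back when x is in the state,
   respectively when y is not: [x |: s] creates the loop and [y |: s] goes through. *)
have H (s : {set crossing D}) : s \subset C :\ x :\ y ->
  [/\ loops (full_smooth (x |: s)) = (par s).+1, loops (full_smooth (y |: s)) = L s
     & loops (full_smooth s) = par s].
  rewrite !subsetD1 -!andbA => /and3P[_ /negPf xs /negPf ys].
  have yx : (y == x) = false by rewrite eq_sym (negPf xy).
  have xyF := negPf xy.
  have off z : z \notin S -> (z == x) = false /\ (z == y) = false.
    by rewrite !inE negb_or => /andP[/negPf-> /negPf->].
  have Lthr : L (y |: s) = L s.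
    apply: eq_loops => z; rewrite /straight_on; case: (boolP (z.1 \in S)) => // /off[zx zy].
    by apply: full_smooth_off_set; rewrite in_setU1 zy.
  split.
  - have E := @bigon_loops_parallel _ d e (x |: (y |: s)) md me xy vd ve (x |: s).
    rewrite -/x -/y od oe !in_setU1 ?eqxx ?yx ?xyF ?xs ?ys /= in E.
    apply: etrans (E _ isT isT) (addn1 _).
    by move=> z /off[zx zy]; rewrite !in_setU1 zx zy.
  - have E := @bigon_loops_through _ d e (y |: s) md me xy vd ve.
    rewrite -/x -/y od oe !in_setU1 ?eqxx ?xyF ?xs /= in E.
    rewrite -Lthr; unfold L, S; apply: E; first exact: erefl.
    exact: erefl.
  - have E := @bigon_loops_parallel _ d e (x |: (y |: s)) md me xy vd ve s.
    rewrite -/x -/y od oe !in_setU1 ?eqxx ?yx ?xyF ?xs ?ys /= in E.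
    apply: etrans (E _ isT isT) (addn0 _).
    by move=> z /off[zx zy]; rewrite !in_setU1 zx zy.
have E1 : state_sum C (fun s => loops (full_smooth s))
    = state_sum (C :\ x :\ y) (fun s => loops (full_smooth (y |: s))).
  by apply: (state_sum_bigon xC yC) => s /H[E E' E'']; exact: conj E E''.
have E2 : state_sum (C :\ x :\ y) (fun s => loops (full_smooth (y |: s)))
    = state_sum (C :\ x :\ y) L by apply: eq_state_sum => s /H[].
have E := etrans E1 E2.
exact E.
Qed.

(** * The triangle *)

Local Open Scope nat_scope.

Lemma expn2_88 m n : (8 * 2 ^ m = 8 * 2 ^ n)%N -> m = n.
Proof. by move/eqP; rewrite eqn_pmul2l // => /eqP/expnI->. Qed.

Lemma expn2_48 m n : (4 * 2 ^ m = 8 * 2 ^ n)%N -> m = (n + 1)%N.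
Proof.
have -> : (8 * 2 ^ n = 2 ^ n.+3)%N by rewrite !expnS !mulnA.
have -> : (4 * 2 ^ m = 2 ^ m.+2)%N by rewrite !expnS !mulnA.
by rewrite addn1 => /(@expnI 2 isT)[].
Qed.

Section Triangle.
Variable D : prediagram.
Local Notation F := {ffun dart D -> bool}.
Local Notation rot2 d := (rot4 (rot4 d)).
Local Notation rot3 d := (rot4 (rot4 (rot4 d))).
Local Notation rot_neqE := (inj_eq (@rot4_inj D), rot4_eqF).

Variables (d e g : dart D) (s0 : {set crossing D}) (swap : dart D -> dart D).
Hypotheses (mate_d : mate d = rot3 e) (mate_e : mate e = rot3 g) (mate_g : mate g = rot3 d).
Hypotheses (de : d.1 != e.1) (eg : e.1 != g.1) (gd : g.1 != d.1).
Hypotheses (vd : ~~ virtual d.1) (ve : ~~ virtual e.1) (vg : ~~ virtual g.1).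
Hypothesis swap_d : (swap d = rot4 e) * (swap (rot4 d) = g) *
  (swap (rot2 d) = rot3 e) * (swap (rot3 d) = rot2 g).
Hypothesis swap_e : (swap e = rot4 g) * (swap (rot4 e) = d) *
  (swap (rot2 e) = rot3 g) * (swap (rot3 e) = rot2 d).
Hypothesis swap_g : (swap g = rot4 d) * (swap (rot4 g) = e) *
  (swap (rot2 g) = rot3 d) * (swap (rot3 g) = rot2 e).
Let S := [set d.1; e.1; g.1].
Hypothesis swap_off : forall z : dart D, z.1 \notin S -> swap z = z.

Let j := full_smooth s0.
Let ed : e.1 != d.1. Proof. by rewrite eq_sym. Qed.
Let ge : g.1 != e.1. Proof. by rewrite eq_sym. Qed.
Let dg : d.1 != g.1. Proof. by rewrite eq_sym. Qed.
Let dS : d.1 \in S. Proof. by rewrite !inE eqxx. Qed.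
Let eS : e.1 \in S. Proof. by rewrite !inE eqxx orbT. Qed.
Let gS : g.1 \in S. Proof. by rewrite !inE eqxx orbT. Qed.

Let Sds x : (x \in S) = (x \in [seq y.1 | y <- [:: d; e; g]]).
Proof. by rewrite !inE orbA. Qed.

Lemma triangle_dart (z : dart D) : z.1 \in S ->
  exists2 y, y \in [:: d; e; g] & z \in [:: y; rot4 y; rot2 y; rot3 y].
Proof. by rewrite Sds => /mapP[y yds zy]; exists y => //; apply: dart_rot4. Qed.

Lemma swapK : involutive swap.
Proof.
move=> z; have [/triangle_dart[y yds zy]|zS] := boolP (z.1 \in S); last by rewrite !swap_off.
move: yds zy; rewrite !inE => /or3P[]/eqP-> /or4P[]/eqP->;
  by rewrite ?swap_d ?swap_e ?swap_g ?swap_d ?swap_e ?swap_g.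
Qed.

Lemma swap_in (z : dart D) : ((swap z).1 \in S) = (z.1 \in S).
Proof.
have [/triangle_dart[y yds zy]|zS] := boolP (z.1 \in S); last by rewrite swap_off ?(negPf zS).
by move: yds zy; rewrite !inE => /or3P[]/eqP-> /or4P[]/eqP->;
  rewrite ?swap_d ?swap_e ?swap_g /= !eqxx ?orbT.
Qed.

(* After the third move, the diagram has the same [mate] in the coordinates
   given by the exchange of darts [swap]; only the smoothings are conjugated. *)
Definition swap_smooth s z := swap (full_smooth s (swap z)).

Lemma swap_smoothK s : involutive (swap_smooth s).
Proof. by move=> z; rewrite /swap_smooth swapK full_smoothK swapK. Qed.

Section State.
Variable s : {set crossing D}.
Hypothesis ss0 : forall x, x \notin S -> (x \in s) = (x \in s0).

Let js (z : dart D) : z.1 \notin S -> full_smooth s z = j z.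
Proof. by move=> zS; apply: full_smooth_off_set; apply: ss0. Qed.

Let card_D := card_invariant_at (@full_smoothK D s) js Sds.

Let card_D' :
  #|[pred c : F | invariant_off j S c &&
       all (invariant_at (full_smooth s) (fun z => c (swap z))) [:: d; e; g]]|
    = 2 ^ n_comp (step_rel (swap_smooth s)) {: dart D}.
Proof.
rewrite -(card_step (swap_smoothK s)); apply: eq_card => c; rewrite !inE /invariant_off -andbA.
congr (_ && _).
rewrite -(forall_crossings (fun z => c (swap (full_smooth s z)) == c (swap z)) Sds).
apply/andP/forallP => [[/forallP cS /forallP cS'] z|cj].
  have := cS (swap z); have := cS' (swap z); rewrite swap_in.
  case: (boolP (z.1 \in S)) => /= zS; first by rewrite /swap_smooth swapK.
  by rewrite /swap_smooth (swap_off zS) js // swap_off // full_smooth1.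
split; apply/forallP=> z; apply/implyP=> zS.
  by have := cj z; rewrite /swap_smooth swap_off // js // swap_off // full_smooth1.
by have := cj (swap z); rewrite /swap_smooth swapK.
Qed.

Let ud := pred2 d (mate d).
Let ue := pred2 e (mate e).
Let ug := pred2 g (mate g).
Definition outer_darts : seq (dart D) := [:: rot4 d; rot2 d; rot4 e; rot2 e; rot4 g; rot2 g].

Let u_out u : u = ud \/ u = ue \/ u = ug -> {in outer_darts, forall z, u z = false}.
Proof.
move=> uu z; rewrite !inE.
by case: uu => [->|[]->]; do ![case/orP=> [/eqP->|]|move/eqP->];
  rewrite /ud /ue /ug /= ?mate_d ?mate_e ?mate_g ?rot_neqE ?neqF.
Qed.

Definition agree (r : seq (dart D * dart D)) (c : F) := all (fun p => c p.1 == c p.2) r.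

Definition outer_pairs (r : seq (dart D * dart D)) :=
  all (fun p => (p.1 \in outer_darts) && (p.2 \in outer_darts)) r.

Let X r : pred F := fun c => invariant_off j S c && agree r c.

Let X_flip r u c : outer_pairs r -> u = ud \/ u = ue \/ u = ug -> X r (flip u c) = X r c.
Proof.
move=> r_out uu; congr (_ && _).
  by case: uu => [->|[]->]; apply: invariant_off_flip; rewrite ?mate_d ?mate_e ?mate_g //;
    exact: full_smooth1.
apply: eq_in_all => p /(allP r_out)/andP[p1 p2].
by rewrite !ffunE !(u_out uu).
Qed.

Let uE : [/\ (ud d = true) * (ud e = false) * (ud g = false),
  (ue d = false) * (ue e = true) * (ue g = false) &
  (ug d = false) * (ug e = false) * (ug g = true)].
Proof.
by rewrite /ud /ue /ug /= mate_d mate_e mate_g !rot_neqE !eqxx !neqF.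
Qed.

Let card8 r o1 o2 o3 : outer_pairs r -> all [in outer_darts] [:: o1; o2; o3] ->
  #|X r| = (8 * #|[pred c : F | X r c && [&& c d == c o1, c e == c o2 & c g == c o3]]|)%N.
Proof.
move=> r_out /and4P[o1_out o2_out o3_out _]; have [Ed Ee Eg] := uE.
have Hd : ud = ud \/ ud = ue \/ ud = ug by left.
have He : ue = ud \/ ue = ue \/ ue = ug by right; left.
have Hg : ug = ud \/ ug = ue \/ ug = ug by right; right.
apply: (@card_flip3 _ _ ud ue ug) => [c|c|c||||||]; try by apply: X_flip.
- by rewrite (u_out Hd o1_out) Ed.
- by rewrite (u_out He o1_out) Ee.
- by rewrite (u_out He o2_out) Ee.
- by rewrite (u_out Hg o1_out) Eg.
- by rewrite (u_out Hg o2_out) Eg.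
- by rewrite (u_out Hg o3_out) Eg.
Qed.

(** The three equations of a loop inside the triangle are cyclic, so only two of them are
    independent. *)
Let card4 r : outer_pairs r ->
  #|X r| = (4 * #|[pred c : F | X r c && ((c d == c e) && (c e == c g))]|)%N.
Proof.
move=> r_out; have [Ed Ee Eg] := uE.
have Hd : ud = ud \/ ud = ue \/ ud = ug by left.
have Hg : ug = ud \/ ug = ue \/ ug = ug by right; right.
apply: (@card_flip2 _ _ ud ug) => [c|c|||]; try by apply: X_flip.
all: by rewrite ?Ed ?Ee ?Eg.
Qed.

Let inv_mate c : invariant_off j S c ->
  [/\ c (rot3 e) = c d, c (rot3 g) = c e & c (rot3 d) = c g].
Proof.
by move=> inv; rewrite -mate_d -mate_e -mate_g !(invariant_off_mate _ inv).
Qed.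

(** These are the five planar pairings of the six outer ends, in the cyclic order [rot4 d],
    [rot2 d], [rot4 g], [rot2 g], [rot4 e], [rot2 e]. The move acts as a half turn: it exchanges
    [r_par] and [r_par'] and fixes the other three. *)
Let r_par := [:: (rot4 d, rot2 d); (rot4 e, rot2 e); (rot4 g, rot2 g)].
Let r_par' := [:: (rot4 e, rot2 g); (rot4 g, rot2 d); (rot4 d, rot2 e)].
Let r_thr := [:: (rot4 d, rot2 e); (rot2 d, rot4 e); (rot4 g, rot2 g)].
Let r_x := [:: (rot4 d, rot2 d); (rot4 g, rot2 e); (rot4 e, rot2 g)].
Let r_y := [:: (rot4 d, rot2 g); (rot2 d, rot4 g); (rot4 e, rot2 e)].

Let r_outer : [/\ outer_pairs r_par, outer_pairs r_par', outer_pairs r_thr,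
  outer_pairs r_x & outer_pairs r_y].
Proof. by rewrite /outer_pairs /= !inE !eqxx ?orbT. Qed.

(* The pairs of ends of the triangle joined by a state are listed in r; the
   factor k is 4 if the state has a loop inside of the triangle, and else 8. *)
Definition tri_count (r : seq (dart D * dart D)) (k : nat) (jj : dart D -> dart D) :=
  #|X r| = (k * 2 ^ n_comp (step_rel jj) {: dart D})%N.

Let o_out : [/\ rot4 d \in outer_darts, rot2 d \in outer_darts, rot4 e \in outer_darts &
  [/\ rot2 e \in outer_darts, rot4 g \in outer_darts & rot2 g \in outer_darts]].
Proof. by rewrite !inE !eqxx ?orbT. Qed.

Let card_state r (A B : pred F) :
    (forall c : F, c (rot3 e) = c d -> c (rot3 g) = c e -> c (rot3 d) = c g ->
      A c = agree r c && B c) ->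
  #|[pred c : F | X r c && B c]| = #|[pred c : F | invariant_off j S c && A c]|.
Proof.
move=> AB; apply: eq_card => c; rewrite !inE /X.
by case inv: (invariant_off j S c) => //=; have [? ? ?] := inv_mate inv; rewrite AB.
Qed.

Ltac solve_state td te tg :=
  congr (_ * _)%N; apply: card_state => ?;
  rewrite /agree /= !invariant_at_full_smooth // td te tg ?swap_d ?swap_e ?swap_g !andbT;
  move=> -> -> ->;
  rewrite -!andbA; apply/idP/idP; repeat (case/andP=> /eqP; first [move=> -> | move=> _]);
  move=> /eqP; first [move=> -> | move=> _];
  by rewrite ?eqxx.

Lemma triangle_smooth :
  match (d.1 \in s) == over d, (e.1 \in s) == over e, (g.1 \in s) == over g with
  | true, true, true => tri_count r_par 4 (full_smooth s)
  | true, false, true | false, true, true => tri_count r_par 8 (full_smooth s)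
  | false, false, true => tri_count r_thr 8 (full_smooth s)
  | true, true, false => tri_count r_par 8 (full_smooth s)
  | false, false, false => tri_count r_par' 8 (full_smooth s)
  | true, false, false => tri_count r_x 8 (full_smooth s)
  | false, true, false => tri_count r_y 8 (full_smooth s)
  end.
Proof.
rewrite /tri_count -card_D; have [o1 o2 o3 [o4 o5 o6]] := o_out.
have [q1 q2 q3 q4 q5] := r_outer.
case td: (_ == _); case te: (_ == _); case tg: (_ == _).
- rewrite (card4 q1); solve_state td te tg.
- rewrite (@card8 _ (rot4 g) (rot4 g) (rot4 g) q1) /= ?o1 ?o2 ?o3 ?o4 ?o5 ?o6 //;
    solve_state td te tg.
- rewrite (@card8 _ (rot4 e) (rot4 e) (rot4 e) q1) /= ?o1 ?o2 ?o3 ?o4 ?o5 ?o6 //;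
    solve_state td te tg.
- rewrite (@card8 _ (rot4 g) (rot4 e) (rot4 g) q4) /= ?o1 ?o2 ?o3 ?o4 ?o5 ?o6 //;
    solve_state td te tg.
- rewrite (@card8 _ (rot4 d) (rot4 d) (rot4 d) q1) /= ?o1 ?o2 ?o3 ?o4 ?o5 ?o6 //;
    solve_state td te tg.
- rewrite (@card8 _ (rot4 d) (rot4 d) (rot4 (rot4 d)) q5) /= ?o1 ?o2 ?o3 ?o4 ?o5 ?o6 //;
    solve_state td te tg.
- rewrite (@card8 _ (rot4 d) (rot4 (rot4 d)) (rot4 (rot4 d)) q3) /= ?o1 ?o2 ?o3 ?o4 ?o5 ?o6 //;
    solve_state td te tg.
- rewrite (@card8 _ (rot4 d) (rot4 e) (rot4 (rot4 d)) q2) /= ?o1 ?o2 ?o3 ?o4 ?o5 ?o6 //;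
    solve_state td te tg.
Qed.

Lemma triangle_swap_smooth :
  match (d.1 \in s) == over d, (e.1 \in s) == over e, (g.1 \in s) == over g with
  | true, true, true => tri_count r_par' 4 (swap_smooth s)
  | true, false, true | false, true, true => tri_count r_par' 8 (swap_smooth s)
  | false, false, true => tri_count r_thr 8 (swap_smooth s)
  | true, true, false => tri_count r_par' 8 (swap_smooth s)
  | false, false, false => tri_count r_par 8 (swap_smooth s)
  | true, false, false => tri_count r_x 8 (swap_smooth s)
  | false, true, false => tri_count r_y 8 (swap_smooth s)
  end.
Proof.
rewrite /tri_count -card_D'; have [o1 o2 o3 [o4 o5 o6]] := o_out.
have [q1 q2 q3 q4 q5] := r_outer.
case td: (_ == _); case te: (_ == _); case tg: (_ == _).
- rewrite (card4 q2); solve_state td te tg.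
- rewrite (@card8 _ (rot4 d) (rot4 d) (rot4 d) q2) /= ?o1 ?o2 ?o3 ?o4 ?o5 ?o6 //;
    solve_state td te tg.
- rewrite (@card8 _ (rot4 (rot4 d)) (rot4 (rot4 d)) (rot4 (rot4 d)) q2) /= ?o1 ?o2 ?o3 ?o4 ?o5 ?o6 //;
    solve_state td te tg.
- rewrite (@card8 _ (rot4 g) (rot4 d) (rot4 g) q4) /= ?o1 ?o2 ?o3 ?o4 ?o5 ?o6 //;
    solve_state td te tg.
- rewrite (@card8 _ (rot4 e) (rot4 e) (rot4 e) q2) /= ?o1 ?o2 ?o3 ?o4 ?o5 ?o6 //;
    solve_state td te tg.
- rewrite (@card8 _ (rot4 d) (rot4 d) (rot4 e) q5) /= ?o1 ?o2 ?o3 ?o4 ?o5 ?o6 //;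
    solve_state td te tg.
- rewrite (@card8 _ (rot4 g) (rot4 (rot4 d)) (rot4 (rot4 d)) q3) /= ?o1 ?o2 ?o3 ?o4 ?o5 ?o6 //;
    solve_state td te tg.
- rewrite (@card8 _ (rot4 g) (rot4 d) (rot4 e) q1) /= ?o1 ?o2 ?o3 ?o4 ?o5 ?o6 //;
    solve_state td te tg.
Qed.

End State.
Let eq88 r j1 j2 : tri_count r 8 j1 -> tri_count r 8 j2 -> loops j1 = loops j2.
Proof.
by move=> H1 H2; rewrite /loops (expn2_88 (etrans (esym H1) H2)).
Qed.

Let eq48 r j1 j2 : tri_count r 4 j1 -> tri_count r 8 j2 -> loops j1 = (loops j2).+1.
Proof.
by move=> H1 H2; rewrite /loops (expn2_48 (etrans (esym H1) H2)) addnA addn1.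
Qed.

Section TwoStates.
Variables s s' : {set crossing D}.
Hypothesis ss0 : forall x, x \notin [set d.1; e.1; g.1] -> (x \in s) = (x \in s0).
Hypothesis ss0' : forall x, x \notin [set d.1; e.1; g.1] -> (x \in s') = (x \in s0).

Lemma triangle_bigon_loop :
    ((d.1 \in s) == over d) = true -> ((e.1 \in s) == over e) = true ->
    ((g.1 \in s) == over g) = true ->
    ((d.1 \in s') == over d) = ~~ ((e.1 \in s') == over e) ->
    ((g.1 \in s') == over g) = true ->
  loops (full_smooth s) = (loops (full_smooth s')).+1 /\
  loops (swap_smooth s) = (loops (swap_smooth s')).+1.
Proof.
move=> td te tg td' tg'.
move: (triangle_smooth ss0) (triangle_smooth ss0').
move: (triangle_swap_smooth ss0) (triangle_swap_smooth ss0').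
rewrite td te tg td' tg'; case: ((e.1 \in s') == over e) => /= H1 H2 H3 H4.
  by split; [apply: eq48 H3 H4 | apply: eq48 H1 H2].
by split; [apply: eq48 H3 H4 | apply: eq48 H1 H2].
Qed.

Lemma triangle_bigon_parallel :
    ((d.1 \in s) == over d) = ~~ ((e.1 \in s) == over e) ->
    ((g.1 \in s) == over g) = true ->
    ((d.1 \in s') == over d) = ~~ ((e.1 \in s') == over e) ->
    ((g.1 \in s') == over g) = true ->
  loops (full_smooth s) = loops (full_smooth s') /\
  loops (swap_smooth s) = loops (swap_smooth s').
Proof.
move=> td tg td' tg'.
move: (triangle_smooth ss0) (triangle_smooth ss0').
move: (triangle_swap_smooth ss0) (triangle_swap_smooth ss0').
rewrite td tg td' tg'; case: ((e.1 \in s') == over e); case: ((e.1 \in s) == over e);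
  by move=> /= H1 H2 H3 H4; split; [apply: eq88 H3 H4 | apply: eq88 H1 H2].
Qed.

Lemma triangle_bigon_through :
    ((d.1 \in s) == over d) = false -> ((e.1 \in s) == over e) = false ->
    ((g.1 \in s) == over g) = true ->
  loops (full_smooth s) = loops (swap_smooth s).
Proof.
move=> td te tg; move: (triangle_smooth ss0) (triangle_swap_smooth ss0).
by rewrite td te tg => /= H1 H2; apply: eq88 H1 H2.
Qed.

Lemma triangle_same :
    ((d.1 \in s) == over d) = ~~ ((e.1 \in s) == over e) ->
    ((g.1 \in s) == over g) = false ->
  loops (full_smooth s) = loops (swap_smooth s).
Proof.
move=> td tg; move: (triangle_smooth ss0) (triangle_swap_smooth ss0).
by rewrite td tg; case: ((e.1 \in s) == over e) => /= H1 H2; apply: eq88 H1 H2.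
Qed.

Lemma triangle_exchange :
    ((d.1 \in s) == over d) = true -> ((e.1 \in s) == over e) = true ->
    ((g.1 \in s) == over g) = false ->
    ((d.1 \in s') == over d) = false -> ((e.1 \in s') == over e) = false ->
    ((g.1 \in s') == over g) = false ->
  loops (full_smooth s) = loops (swap_smooth s') /\
  loops (full_smooth s') = loops (swap_smooth s).
Proof.
move=> td te tg td' te' tg'.
move: (triangle_smooth ss0) (triangle_smooth ss0').
move: (triangle_swap_smooth ss0) (triangle_swap_smooth ss0').
rewrite td te tg td' te' tg' => /= H1 H2 H3 H4.
by split; [apply: eq88 H3 H2 | apply: eq88 H4 H1].
Qed.
End TwoStates.
End Triangle.

(** * Third move and conclusion *)

Local Open Scope ring_scope.

Lemma bijective_n_comp (T T' : finType) (h : T' -> T) (e : rel T) (e' : rel T') :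
    bijective h -> connect_sym e -> connect_sym e' ->
    (forall x y, e (h x) (h y) = e' x y) ->
  n_comp e T = n_comp e' T'.
Proof.
move=> h_bij eS e'S ee'; have h_inj := bij_inj h_bij.
have cl : closed e T by [].
rewrite (adjunction_n_comp h eS e'S cl) //.
apply: strict_adjunction => //.
by case: h_bij => k _ kK; apply/subsetP=> x _; rewrite -[x]kK codom_f.
Qed.

Section TriangleMove.
Variables (D : diagram) (d e g : dart D).
Local Notation rot2 d := (rot4 (rot4 d)).
Local Notation rot3 d := (rot4 (rot4 (rot4 d))).
Local Notation rot_neqE := (inj_eq (@rot4_inj D), rot4_eqF).
Hypotheses (face_d : face d = e) (face_e : face e = g) (face_g : face g = d).
Hypothesis uniq_d : uniq [seq c.1 | c <- triangle d].

Lemma triangleE : triangle d = [:: d; e; g].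
Proof. by rewrite /triangle face_d face_e. Qed.

Lemma triangle_crossings : [/\ d.1 != e.1, e.1 != g.1 & g.1 != d.1].
Proof.
move: uniq_d; rewrite triangleE /= !inE negb_or => /andP[/andP[de dg] /andP[eg _]].
by split; rewrite // eq_sym.
Qed.

Lemma triangle_mates : [/\ mate d = rot3 e, mate e = rot3 g & mate g = rot3 d].
Proof. by split; apply: face_eq. Qed.

Lemma swap3_inner (z : dart D) :
    z \in triangle d -> swap3 d z = straight (mate z) /\ swap3 d (mate z) = straight z.
Proof.
move=> zd; have zS : z.1 \in [seq c.1 | c <- triangle d] by apply: map_f.
have mS : (mate z).1 \in [seq c.1 | c <- triangle d].
  have [m1 m2 m3] := triangle_mates.
  by move: zd; rewrite triangleE !inE => /or3P[]/eqP->; rewrite ?m1 ?m2 ?m3 /= eqxx ?orbT.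
by rewrite /swap3 zS mS /= mateK zd orbT.
Qed.

Lemma swap3_outer (z : dart D) :
    z.1 \in [seq c.1 | c <- triangle d] -> z \notin triangle d -> mate z \notin triangle d ->
  swap3 d z = mate (straight z).
Proof. by move=> zS zd mzd; rewrite /swap3 zS /= (negPf zd) (negPf mzd). Qed.

Lemma swap3_off (z : dart D) : z.1 \notin [set d.1; e.1; g.1] -> swap3 d z = z.
Proof.
by move=> zS; rewrite /swap3 triangleE !inE; move: zS; rewrite !inE orbA => ->.
Qed.

Let mate_eq (a b : dart D) : (mate a == b) = (a == mate b).
Proof. exact: can2_eq (@mateK D) (@mateK D) _ _. Qed.

Lemma swap3_rot4 (y : dart D) : y \in triangle d ->
  swap3 d (rot4 y) = mate (rot3 y) /\ swap3 d (rot2 y) = mate y.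
Proof.
have [de eg gd] := triangle_crossings; have [m1 m2 m3] := triangle_mates.
have [ed ge dg] : [/\ e.1 != d.1, g.1 != e.1 & d.1 != g.1] by split; rewrite eq_sym.
move=> yd; have yS : y.1 \in [seq c.1 | c <- triangle d] by apply: map_f.
split; rewrite swap3_outer //= ?/straight ?rot4_4 //.
all: move: yd; rewrite triangleE !inE ?mate_eq ?m1 ?m2 ?m3; case/or3P=> /eqP->.
all: by rewrite ?mate_eq ?m1 ?m2 ?m3 !rot_neqE !neqF.
Qed.

Lemma swap3_values (y z w : dart D) : y \in triangle d -> w \in triangle d ->
    mate y = rot3 z -> mate w = rot3 y ->
  (swap3 d y = rot4 z) * (swap3 d (rot4 y) = w) *
  (swap3 d (rot2 y) = rot3 z) * (swap3 d (rot3 y) = rot2 w).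
Proof.
move=> yd wd my mw; have [-> _] := swap3_inner yd; have [-> ->] := swap3_rot4 yd.
have [_] := swap3_inner wd; rewrite mw => ->.
by rewrite -mw mateK my /straight rot4_4.
Qed.

End TriangleMove.

(** The states [x |: s] and [y |: s] have the same weight, so their loop counts may be exchanged. *)
Lemma state_sum_exchange (X : finType) (C : {set X}) x y L L' :
    x \in C -> y \in C :\ x ->
    (forall s : {set X}, s \subset C :\ x :\ y ->
       [/\ L (x |: (y |: s)) = L' (x |: (y |: s)), L (x |: s) = L' (y |: s),
           L (y |: s) = L' (x |: s) & L s = L' s]) ->
  state_sum C L = state_sum C L'.
Proof.
move=> xC yC HL; rewrite (state_sum_split2 L xC yC) (state_sum_split2 L' xC yC).
have E1 : state_sum (C :\ x :\ y) (fun s => L (x |: (y |: s)))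
    = state_sum (C :\ x :\ y) (fun s => L' (x |: (y |: s))).
  by apply: eq_state_sum => s /HL[].
have E2 : state_sum (C :\ x :\ y) (fun s => L (x |: s))
    = state_sum (C :\ x :\ y) (fun s => L' (y |: s)).
  by apply: eq_state_sum => s /HL[].
have E3 : state_sum (C :\ x :\ y) (fun s => L (y |: s))
    = state_sum (C :\ x :\ y) (fun s => L' (x |: s)).
  by apply: eq_state_sum => s /HL[].
have E4 : state_sum (C :\ x :\ y) L = state_sum (C :\ x :\ y) L'.
  by apply: eq_state_sum => s /HL[].
rewrite E1 E2 E3 E4 !mulrDr !mulrA mulfV ?mulVf ?varA_neq0 // -!addrA.
by congr (_ + _); rewrite addrCA.
Qed.

Section Reidemeister3Bracket.
Variables (D D' : diagram) (d : dart D) (f : dart D -> dart D').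
Local Notation rot2 d := (rot4 (rot4 d)).
Local Notation rot3 d := (rot4 (rot4 (rot4 d))).
Hypotheses (uniq_d : uniq [seq c.1 | c <- triangle d]).
Hypothesis (vd : {in triangle d, forall c, ~~ virtual c.1}).
Hypothesis (od : over d) (omd : over (mate d)).
Hypothesis f_compat : compatible f.
Hypothesis f_bij : bijective f.
Hypothesis f_mate : forall c, mate (f c) = f (swap3 d (mate (swap3 d c))).
Hypothesis circlesE : circles D' = circles D.
Variables e g : dart D.
Hypotheses (face_d : face d = e) (face_e : face e = g) (face_g : face g = d).

Let de : d.1 != e.1. Proof. by have [] := triangle_crossings face_d face_e uniq_d. Qed.
Let eg : e.1 != g.1. Proof. by have [] := triangle_crossings face_d face_e uniq_d. Qed.
Let gd : g.1 != d.1. Proof. by have [] := triangle_crossings face_d face_e uniq_d. Qed.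
Let md : mate d = rot3 e. Proof. exact: face_eq. Qed.
Let me : mate e = rot3 g. Proof. exact: face_eq. Qed.
Let mg : mate g = rot3 d. Proof. exact: face_eq. Qed.
Let tri : triangle d = [:: d; e; g]. Proof. exact: triangleE. Qed.
Let d_tri : d \in triangle d. Proof. by rewrite tri !inE eqxx. Qed.
Let e_tri : e \in triangle d. Proof. by rewrite tri !inE eqxx orbT. Qed.
Let g_tri : g \in triangle d. Proof. by rewrite tri !inE eqxx !orbT. Qed.
Let swap_d := swap3_values face_d face_e face_g uniq_d d_tri g_tri md mg.
Let swap_e := swap3_values face_d face_e face_g uniq_d e_tri d_tri me md.
Let swap_g := swap3_values face_d face_e face_g uniq_d g_tri e_tri mg me.
Let swap_off := swap3_off face_d face_e.
Let swap3K : involutive (swap3 d) := swapK swap_d swap_e swap_g swap_off.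
Let oe : over e = false. Proof. by rewrite -face_d /face over_rot4 omd. Qed.

Let f_inj : injective f. Proof. exact: bij_inj. Qed.

Lemma loops_triangle_move (s : {set crossing D}) :
  loops (full_smooth (crossing_map f @: s)) = loops (swap_smooth (swap3 d) s).
Proof.
rewrite /loops circlesE; congr (circles D + _)%N.
apply: (@bijective_n_comp _ _ (fun z => f (swap3 d z))).
- by apply: bij_comp f_bij (inv_bij swap3K).
- exact: step_sym (@full_smoothK _ _).
- exact: step_sym (swap_smoothK swap_d swap_e swap_g swap_off s).
move=> a b; rewrite /step_rel /= f_mate -(compatible_full_smooth f_inj f_compat).
rewrite swap3K -[full_smooth s (swap3 d a)]swap3K -/(swap_smooth _ s a).
by rewrite !(inj_eq f_inj) !(inj_eq (inv_inj swap3K)).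
Qed.

Lemma classical_triangle_move :
  classical_crossings D' = crossing_map f @: classical_crossings D.
Proof.
have [_ fv _] := f_compat; apply/setP=> y; apply/idP/imsetP=> [yC | [x xC ->]].
  have [k _ kK] := f_bij; exists (k (y, ord0)).1; last by rewrite -crossing_mapE // kK.
  by move: yC; rewrite !inE -fv kK.
exact: (classical_imset f_compat).
Qed.

Let x := d.1.
Let y := e.1.
Let z := g.1.
Let C := classical_crossings D.
Let L1 (s : {set crossing D}) := loops (full_smooth s).
Let L2 (s : {set crossing D}) := loops (swap_smooth (swap3 d) s).
Let xC : x \in C :\ z. Proof. by rewrite !inE eq_sym gd vd. Qed.
Let yC : y \in C :\ z :\ x. Proof. by rewrite !inE eg eq_sym de vd. Qed.
Let zC : z \in C. Proof. by rewrite inE vd. Qed.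

Let smooth_z (b : bool) (s : {set crossing D}) := if b then z |: s else s.

(** Kauffman's argument: z is the corner avoided by the upper strand, and the diagrams before and
    after the move are compared for each smoothing of z separately. *)
Lemma state_sum_triangle b :
  state_sum (C :\ z) (fun s => L1 (smooth_z b s)) =
  state_sum (C :\ z) (fun s => L2 (smooth_z b s)).
Proof.
have [xy yx] : (x == y) = false /\ (y == x) = false.
  by rewrite [y == x]eq_sym !(negPf de).
have [yz zy] : (y == z) = false /\ (z == y) = false.
  by rewrite [z == y]eq_sym !(negPf eg).
have [zx xz] : (z == x) = false /\ (x == z) = false.
  by rewrite [x == z]eq_sym !(negPf gd).
have smooth_zE (s : {set crossing D}) u :
    (u \in smooth_z b s) = (b && (u == z)) || (u \in s).
  by rewrite /smooth_z; case: b; rewrite ?in_setU1.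
have off u : u \notin [set x; y; z] -> [/\ (u == x) = false, (u == y) = false & (u == z) = false].
  by rewrite !inE !negb_or -andbA => /and3P[/negPf-> /negPf-> /negPf->].
have vx := vd d_tri; have vy := vd e_tri; have vz := vd g_tri.
have bits (s : {set crossing D}) : s \subset C :\ z :\ x :\ y ->
    [/\ (x \in s) = false, (y \in s) = false & (z \in s) = false].
  by rewrite !subsetD1 -!andbA => /and4P[_ /negPf-> /negPf-> /negPf->].
have agree_off (s t : {set crossing D}) :
    (t = s \/ t = x |: s) \/ (t = y |: s \/ t = x |: (y |: s)) ->
    forall u, u \notin [set x; y; z] -> (u \in smooth_z b t) = (u \in s).
  by move=> st u /off[ux uy uz]; move: st => [[]|[]] ->;
    rewrite smooth_zE ?in_setU1 ?ux ?uy uz andbF.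
(* With the corner at z turned back, the upper strand forms a bigon with the arc thus created,
   before and after the move. Undoing both bigons leaves the same states. *)
case tz: (b == over g).
  have bigon (s : {set crossing D}) : s \subset C :\ z :\ x :\ y ->
      [/\ L1 (smooth_z b (x |: s)) = (L1 (smooth_z b (x |: (y |: s)))).+1 /\
          L2 (smooth_z b (x |: s)) = (L2 (smooth_z b (x |: (y |: s)))).+1,
          L1 (smooth_z b s) = L1 (smooth_z b (x |: (y |: s))) /\
          L2 (smooth_z b s) = L2 (smooth_z b (x |: (y |: s)))
        & L1 (smooth_z b (y |: s)) = L2 (smooth_z b (y |: s))].
    move=> /bits[xs ys zs].
    split.
    - apply: (triangle_bigon_loop (s0 := s) md me mg de eg gd vx vy vz swap_d swap_e swap_g swap_off);
        [by apply: agree_off; left; right | by apply: agree_off; right; right 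
        | by rewrite -/x -/y -/z ?smooth_zE ?in_setU1 ?eqxx ?xs ?ys ?zs ?xy ?yx ?xz ?zx ?yz
            ?zy ?andbT ?andbF ?od ?oe ?orbF ?tz ..].
    - apply: (triangle_bigon_parallel (s0 := s) md me mg de eg gd vx vy vz swap_d swap_e swap_g swap_off);
        [by apply: agree_off; left; left | by apply: agree_off; right; right 
        | by rewrite -/x -/y -/z ?smooth_zE ?in_setU1 ?eqxx ?xs ?ys ?zs ?xy ?yx ?xz ?zx ?yz
            ?zy ?andbT ?andbF ?od ?oe ?orbF ?tz ..].
    - apply: (triangle_bigon_through (s0 := s) md me mg de eg gd vx vy vz swap_d swap_e swap_g swap_off);
        [by apply: agree_off; right; left 
        | by rewrite -/x -/y -/z ?smooth_zE ?in_setU1 ?eqxx ?xs ?ys ?zs ?xy ?yx ?xz ?zx ?yz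
            ?zy ?andbT ?andbF ?od ?oe ?orbF ?tz ..].
  have E1 : state_sum (C :\ z) (fun s => L1 (smooth_z b s)) =
      state_sum (C :\ z :\ x :\ y) (fun s => L1 (smooth_z b (y |: s))).
    by apply: (state_sum_bigon xC yC) => s /bigon[[E _] [E' _] _]; exact: conj E E'.
  have E2 : state_sum (C :\ z) (fun s => L2 (smooth_z b s)) =
      state_sum (C :\ z :\ x :\ y) (fun s => L2 (smooth_z b (y |: s))).
    by apply: (state_sum_bigon xC yC) => s /bigon[[_ E] [_ E'] _]; exact: conj E E'.
  have E3 : state_sum (C :\ z :\ x :\ y) (fun s => L1 (smooth_z b (y |: s))) =
      state_sum (C :\ z :\ x :\ y) (fun s => L2 (smooth_z b (y |: s))).
    by apply: eq_state_sum => s /bigon[].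
  have E := etrans E1 (etrans E3 (esym E2)).
  exact E.
(* With the other smoothing of z, the upper strand crosses two arcs, and the move exchanges the
   roles of x and y. *)
apply: (state_sum_exchange xC yC) => s /bits[xs ys zs].
have ex : L1 (smooth_z b (x |: s)) = L2 (smooth_z b (y |: s)) /\
          L1 (smooth_z b (y |: s)) = L2 (smooth_z b (x |: s)).
- apply: (triangle_exchange (s0 := s) md me mg de eg gd vx vy vz swap_d swap_e swap_g swap_off);
        [by apply: agree_off; left; right | by apply: agree_off; right; left 
        | by rewrite -/x -/y -/z ?smooth_zE ?in_setU1 ?eqxx ?xs ?ys ?zs ?xy ?yx ?xz ?zx ?yz
            ?zy ?andbT ?andbF ?od ?oe ?orbF ?tz ..].
split; [|exact: ex.1 | exact: ex.2|].
- apply: (triangle_same (s0 := s) md me mg de eg gd vx vy vz swap_d swap_e swap_g swap_off);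
        [by apply: agree_off; right; right 
        | by rewrite -/x -/y -/z ?smooth_zE ?in_setU1 ?eqxx ?xs ?ys ?zs ?xy ?yx ?xz ?zx ?yz
            ?zy ?andbT ?andbF ?od ?oe ?orbF ?tz ..].
- apply: (triangle_same (s0 := s) md me mg de eg gd vx vy vz swap_d swap_e swap_g swap_off);
        [by apply: agree_off; left; left 
        | by rewrite -/x -/y -/z ?smooth_zE ?in_setU1 ?eqxx ?xs ?ys ?zs ?xy ?yx ?xz ?zx ?yz
            ?zy ?andbT ?andbF ?od ?oe ?orbF ?tz ..].
Qed.

Lemma bracket_triangle_move : bracket D = bracket D'.
Proof.
rewrite /bracket classical_triangle_move (state_sum_imset _ _ (crossing_map_inj f_inj f_compat)).
transitivity (state_sum C L2); last first.
  by apply: eq_state_sum => s _; rewrite loops_triangle_move.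
apply: etrans (state_sum_split L1 zC) (etrans _ (esym (state_sum_split L2 zC))).
exact: (congr2 (fun a b => varA * a + varA^-1 * b)
  (state_sum_triangle true) (state_sum_triangle false)).
Qed.

End Reidemeister3Bracket.

Lemma Reidemeister3_bracket (D D' : diagram) : Reidemeister3 D D' -> bracket D = bracket D'.
Proof.
case=> d [f [[fffd uniq_d] vd /andP[od om] [f_bij f_compat] [f_mate circlesE]]].
exact: (bracket_triangle_move uniq_d vd od om f_compat f_bij f_mate circlesE
         (erefl _) (erefl _) fffd).
Qed.

(** * Invariance of the grading under equivalence *)

Lemma virtual_move_bracket (D D' : diagram) :
    isomorphic D D' \/ detour D D' \/ detour_circle D D' ->
  bracket D = bracket D'.
Proof.
case=> [[f er] | [[D0 [d0 [S [f [S' [f' [S_virt S'_virt er er']]]]]]] | [c [S [f [_ S_virt er]]]]]].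
- by rewrite -(bracket_erased_virtual er) // => x; rewrite in_set0.
- rewrite -(bracket_erased_virtual er) ?(bracket_erased_virtual er') // => x.
    by case/S'_virt.
  by case/S_virt.
- by rewrite -(bracket_erased_virtual er) // => x /S_virt[].
Qed.

Lemma graded_unit_iff u u' k k' x : graded k u -> graded k' u' -> u' * u = 1 ->
  (exists l, graded l (u * x)) <-> (exists l, graded l x).
Proof.
move=> gu gu' uu; split=> -[l gl]; last by exists (k + l)%N; apply: gradedM.
by exists (k' + l)%N; have := gradedM gu' gl; rewrite mulrA uu mul1r.
Qed.

Lemma move_graded (D D' : diagram) : move D D' ->
  (exists k, graded k (bracket D)) <-> (exists k, graded k (bracket D')).
Proof.
have gA3 : graded 3 (- varA ^+ 3).
  by apply: gradedN; apply: graded_mod (gradedX 3 graded_varA).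
(* Three factors [A ^-1] of degree 3 give 9, which is -3 modulo 4. *)
have gA3' : graded 9 (- varA ^- 3).
  by apply: gradedN; rewrite -exprVn; apply: graded_mod (gradedX 3 graded_varAV).
have A3 : varA ^+ 3 != 0 by rewrite expf_neq0 ?varA_neq0.
case=> [iso|[R1|[R2|[R3|vm]]]].
- by rewrite (virtual_move_bracket (or_introl iso)).
- have [->|->] := Reidemeister1_bracket R1.
    by apply: graded_unit_iff gA3 gA3' _; rewrite mulrNN mulVf.
  by apply: graded_unit_iff gA3' gA3 _; rewrite mulrNN mulfV.
- by rewrite (Reidemeister2_bracket R2).
- by rewrite (Reidemeister3_bracket R3).
- by rewrite (virtual_move_bracket (or_intror vm)).
Qed.

Lemma equivalent_graded (D D' : diagram) : equivalent D D' ->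
  (exists k, graded k (bracket D)) <-> (exists k, graded k (bracket D')).
Proof.
elim=> {D D'} [D D' /move_graded | D | D D' _ [] | D1 D2 D3 _ [f12 f21] _ [f23 f32]] //.
by split=> [/f12/f23 | /f32/f21].
Qed.

Theorem mainTheorem3 (K : diagram) (v : crossing K)
    (K_knot : is_knot K)
    (v_virtual : virtual v)
    (v_unique : forall x : crossing K, virtual x -> x = v)
    (alpha_neq0 : tangle_coef v join01 <> 0)
    (beta_neq0 : tangle_coef v join12 <> 0) :
  non_classical K /\ non_trivial K.
Proof.
have nc : non_classical K.
  case=> D [/equivalent_graded KD /graded_classical/KD].
  exact: not_graded_bracket v_virtual v_unique alpha_neq0 beta_neq0.
(* A crossingless diagram has no virtual crossing, so triviality would contradict
   non-classicality. *)
split=> // -[D [KD D0]]; apply: nc; exists D; split=> // x.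
by have := card0_eq D0 x; rewrite inE.
Qed.
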